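(* The randomized query complexity of the HiddenPermutation problem with $n$ positions is $O(n\log\log n)$. That is, there is a constant $C$ such that for all sufficiently large $n$ there is a randomized strategy which, for every secret $(z,\pi)\in\{0,1\}^n\times S_n$, identifies $(z,\pi)$ with an expected number of at most $C\,n\log\log n$ queries.
   Context: $[n]=\{1,\dots,n\}$, $[0..n]=\{0,1,\dots,n\}$, and $S_n$ is the set of permutations of $[n]$. For $z\in\{0,1\}^n$ and $\pi\in S_n$ define $f_{z,\pi}:\{0,1\}^n\to[0..n]$ by $f_{z,\pi}(x)=\max\{i\in[0..n]\mid \forall j\le i:\ z_{\pi(j)}=x_{\pi(j)}\}$. HiddenPermutation problem: a secret pair $(z,\pi)\in\{0,1\}^n\times S_n$ is to be identified by adaptively asking queries $x^1,x^2,\ldots\in\{0,1\}^n$; the answer to query $x^i$ is the score $s^i=f_{z,\pi}(x^i)$. One may stop after $t$ queries if there is only a single pair $(z',\pi')\in\{0,1\}^n\times S_n$ with $f_{z',\pi'}(x^i)=s^i$ for all $1\le i\le t$; the secret is then identified. A deterministic strategy is a rooted tree of outdegree $n+1$ in which a query in $\{0,1\}^n$ is associated with every (internal) node. The search starts at the root; at a node, the associated query is asked and the search proceeds to the child selected by the score. A randomized strategy is a probability distribution over deterministic strategies. Its complexity on input $(z,\pi)$ is the expected number of queries required to identify the secret, and its complexity is the worst case of this over all inputs. The randomized query complexity is the infimum of the complexities of all randomized strategies. *)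

(* Defs.v *)
From HB Require Import structures.
From mathcomp Require Import all_boot all_order all_algebra all_fingroup.
From mathcomp Require Import all_classical all_reals all_analysis.

Set Implicit Arguments.
Unset Strict Implicit.
Unset Printing Implicit Defensive.

Import Order.TTheory GRing.Theory Num.Theory.

Local Open Scope classical_set_scope.

Definition query (n : nat) := {ffun 'I_n -> bool}.

Definition secret (n : nat) := (query n * {perm 'I_n})%type.

(* Positions are numbered 0, .., n-1 instead of 1, .., n, so that "all positive
   j <= i" becomes "all j < i".  The score is the largest admissible i in
   {0, .., n}; i = 0 always is admissible. *)
Definition score (n : nat) (s : secret n) (x : query n) : 'I_n.+1 :=
  [arg max_(i > (ord0 : 'I_n.+1) |
    [forall j : 'I_n, (j < i) ==> (s.1 (s.2 j) == x (s.2 j))]) (i : nat)].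

(* A rooted tree of outdegree n+1, finite or infinite.  A node is addressed by
   the sequence of scores on the path from the root to it; the tree returns the
   query of an internal node and None at a leaf.  The values at addresses below
   a leaf are never read. *)
Definition strategy (n : nat) := seq 'I_n.+1 -> option (query n).

(* The first t queries that T asks on the secret s, with their answers; None if
   the search arrives at a leaf before t queries have been asked. *)
Fixpoint transcript (n : nat) (T : strategy n) (s : secret n) (t : nat) :
    option (seq (query n * 'I_n.+1)) :=
  if t is t'.+1 then
    if transcript T s t' is Some h then
      if T [seq xa.2 | xa <- h] is Some x then Some (rcons h (x, score s x))
      else None
    else None
  else Some [::].

Definition consistent (n : nat) (h : seq (query n * 'I_n.+1)) :
    {set secret n} :=
  [set s : secret n | all (fun xa => score s xa.1 == xa.2) h]%SET.

Definition identified (n : nat) (T : strategy n) (s : secret n) (t : nat) :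
    Prop :=
  exists2 h, transcript T s t = Some h & #|consistent h| = 1.

(* The least number of queries after which the secret is identified, +oo if it
   never is (ereal_inf set0 = +oo). *)
Definition num_queries (R : realType) (n : nat) (s : secret n)
    (T : strategy n) : \bar R :=
  ereal_inf [set (t%:R)%:E | t in identified T s].

(* Distributions over strategies live on the product sigma-algebra, generated
   by the events "the query at node v is q (or v is a leaf, for q = None)". *)
Definition cylinders (n : nat) : set (set (strategy n)) :=
  [set A | exists v q, A = [set T | T v = q]].

Definition randomized_strategy (R : realType) (n : nat) :=
  probability (g_sigma_algebraType (@cylinders n)) R.

Definition expected_queries (R : realType) (n : nat)
    (P : randomized_strategy R n) (s : secret n) : \bar R :=
  (\int[P]_T num_queries R s T)%E.

Definition complexity (R : realType) (n : nat) (P : randomized_strategy R n) :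
    \bar R :=
  ereal_sup [set expected_queries P s | s in [set: secret n]].

Definition query_complexity (R : realType) (n : nat) : \bar R :=
  ereal_inf [set complexity P | P in [set: randomized_strategy R n]].

(* Main.v *)
Require Import Defs.
From HB Require Import structures.
From mathcomp Require Import all_boot all_order all_algebra all_fingroup.
From mathcomp Require Import boolp reals exp.
From mathcomp Require Import zify ring lra.

(** The cost of a randomized strategy is brought down to an average: relabelling
    positions and values of a fixed decision tree by a uniformly random secret
    makes its expected cost on every secret the average, over all secrets, of
    the cost of the tree.  It remains to build one tree with small total cost.

    The tree maintains a query [x] and disjoint cells [C 0, .., C (k-1)] such
    that the first [k] positions of the secret are answered correctly by [x] and
    the [j]-th of them lies in [C j]; given this, the secret is uniformly
    distributed.  Two kinds of moves drive the process.
    - Let [k'] cells be at least as large as [c], where [k'^4 > n/c].  Flip in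
      [x] a fraction [1/k'] of each.  With probability at least 1/2 one cell is
      hit, and it shrinks by a factor about [k'].
    - Otherwise the cells are so small that the next position lies outside of
      all of them except with small probability; it is then located up to a
      cell of size [n / polylog n] by [O(log log n)] bisections.  If it does lie
      in a cell, the cells are resolved by decreasing size until it is found,
      at an expected cost [O(1)].
    A cell of size [c] carries the potential [ln ln n - ln ln (n/c) + O(1)].  A
    hit lowers it by a constant, since [ln (n/c)] grows by a constant factor;
    so every query of the first kind pays for itself, and the total is
    [O(n ln ln n)].  The last [n / log n] positions are found by plain
    bisection. *)

Set Implicit Arguments.
Unset Strict Implicit.
Unset Printing Implicit Defensive.

Import Order.TTheory GRing.Theory Num.Theory.

(** * Total cost of decision trees *)

Section Trees.
Variables (R : realType) (n : nat).
Local Open Scope ring_scope.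
Implicit Types (A B : {set secret n}) (x : query n) (s : secret n) (c : R).

(** A query is charged once for every secret that reaches it. Bounding this total instead of the
    average avoids divisions by [#|A|] and makes costs additive over disjoint sets. *)
Inductive cost : {set secret n} -> R -> Prop :=
| cost_leaf A c of (#|A| <= 1)%N & 0 <= c : cost A c
| cost_node A x (d : 'I_n.+1 -> R) c of
    (forall i, cost (A :&: [set s | score s x == i])%SET (d i)) &
    #|A|%:R + \sum_i d i <= c : cost A c.

Lemma cost_ge0 A c : cost A c -> 0 <= c.
Proof.
elim=> // {}A x d {}c _ d_ge0; apply: le_trans.
by rewrite addr_ge0 ?ler0n ?sumr_ge0.
Qed.

Lemma cost_le A c c' : c <= c' -> cost A c -> cost A c'.
Proof.
move=> le_c cA; case: cA le_c => {A c} [A c A1 c0|A x d c Ad cd] le_c.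
  by apply: cost_leaf => //; apply: le_trans le_c.
by apply: cost_node Ad _; apply: le_trans le_c.
Qed.

Lemma cost_sub A B c : A \subset B -> cost B c -> cost A c.
Proof.
move=> AB cB; elim: cB A AB => {B c} [B c B1 c0|B x d c _ IH cd] A AB.
  by apply: cost_leaf => //; apply: leq_trans B1; apply: subset_leq_card.
apply: (@cost_node _ x d) => [i|]; first by apply: IH; apply: setSI.
by apply: le_trans cd; rewrite lerD2r ler_nat subset_leq_card.
Qed.

Lemma cost0 c : 0 <= c -> cost set0 c.
Proof. by move=> c0; apply: cost_leaf; rewrite // cards0. Qed.

Lemma card_fibers (G : finType) (g : secret n -> G) A :
  (#|A| = \sum_k #|A :&: g @^-1: [set k]|%SET)%N.
Proof.
rewrite -sum1_card (partition_big g xpredT) //=.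
apply: eq_bigr => k _; rewrite -sum1_card; apply: eq_bigl => s.
by rewrite !inE.
Qed.

(** The same tree serves every fibre of [g], and the charge [#|A|] of its root is the sum of the
    charges of the fibres. *)
Lemma cost_split (G : finType) (g : secret n -> G) A c : cost A c ->
  exists2 d : G -> R, forall k, cost (A :&: g @^-1: [set k])%SET (d k)
                    & \sum_k d k <= c.
Proof.
elim=> {A c} [A c A1 c0|A x d c _ IH cd].
  exists (fun=> 0); last by rewrite big1.
  move=> k; apply: cost_leaf => //; apply: leq_trans A1.
  by rewrite subset_leq_card // subsetIl.
have /choice[d' d'P] : forall i, exists d' : G -> R,
    (forall k, cost (A :&: [set s | score s x == i] :&:
                     g @^-1: [set k])%SET (d' k)) /\ \sum_k d' k <= d i.
  by move=> i; have [d' ? ?] := IH i; exists d'.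
exists (fun k => #|A :&: g @^-1: [set k]|%:R + \sum_i d' i k).
  move=> k; apply: (@cost_node _ x (d'^~ k)) => // i.
  by rewrite setIAC; apply: (d'P i).1.
rewrite big_split /= -natr_sum -card_fibers exchange_big /=.
by apply: le_trans cd; rewrite lerD2l ler_sum // => i _; apply: (d'P i).2.
Qed.

(* An answer may be forgotten in part: only the value of g is remembered. *)
Lemma cost_query (G : finType) (g : secret n -> G) x (d : G -> R) A c :
    {in A &, forall s s', score s x = score s' x -> g s = g s'} ->
    (forall k, cost (A :&: g @^-1: [set k])%SET (d k)) ->
  #|A|%:R + \sum_k d k <= c -> cost A c.
Proof.
move=> gx Ad cd.
have /choice[d' d'P] : forall k, exists d' : 'I_n.+1 -> R,
    (forall i, cost (A :&: g @^-1: [set k] :&: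
                     (fun s => score s x) @^-1: [set i])%SET (d' i))
    /\ \sum_i d' i <= d k.
  by move=> k; have [d' ? ?] := cost_split (fun s => score s x) (Ad k);
    exists d'.
have d'0 k i : 0 <= d' k i by apply: cost_ge0 ((d'P k).1 i).
(* All secrets with score [i] lie in one fibre of [g], so a single [d' k i] suffices below that
   child; summing over all [k] only avoids naming the fibre. *)
apply: (@cost_node _ x (fun i => \sum_k d' k i)) => [i|].
  case: (set_0Vmem (A :&: [set s | score s x == i])%SET) => [->|[s]].
    by apply: cost0; apply: sumr_ge0.
  rewrite !inE => /andP[sA /eqP si].
  apply: (@cost_le _ (d' (g s) i)).
    by rewrite (bigD1 (g s)) //= lerDl sumr_ge0.
  apply: cost_sub ((d'P (g s)).1 i); apply/subsetP => s'.
  rewrite !inE => /andP[s'A /eqP s'i]; rewrite s'A s'i eqxx !andbT /=.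
  by apply/eqP; apply: gx => //; rewrite si.
apply: le_trans cd; rewrite exchange_big /= lerD2l ler_sum // => k _.
exact: (d'P k).2.
Qed.

End Trees.

(** * Queries about the positions already located up to a cell *)

Section States.
Variables (R : realType) (n : nat).
Local Open Scope ring_scope.
Implicit Types (A B : {set secret n}) (x : query n) (s : secret n) (c : R).
Implicit Types (C F : 'I_n -> {set 'I_n}) (P : {set 'I_n}) (k : nat).

Lemma leq_score s x k : (k <= n)%N ->
  (k <= score s x)%N =
  [forall j : 'I_n, (j < k)%N ==> (s.1 (s.2 j) == x (s.2 j))].
Proof.
move=> kn; rewrite /score; case: arg_maxnP => [|i /forallP iP i_max].
  by apply/forallP => j; rewrite ltn0.
apply/idP/idP => [ki|kP].
  by apply/forallP => j; apply/implyP => /leq_trans/(_ ki)/(implyP (iP j)).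
exact: (i_max (Ordinal (kn : (k < n.+1)%N))).
Qed.

Definition agree x k C : {set secret n} :=
  [set s : secret n | [forall j : 'I_n, (j < k)%N ==>
             (s.2 j \in C j) && (s.1 (s.2 j) == x (s.2 j))]]%SET.

Definition disjoint_cells k C := forall i j : 'I_n, (i < k)%N ->
  (j < k)%N -> i != j ->
  forall p, p \in C i -> p \in C j -> False.

Definition flip x P : query n := [ffun p => x p (+) (p \in P)].

Lemma agreeP s x k C :
  reflect (forall j : 'I_n, (j < k)%N ->
    s.2 j \in C j /\ s.1 (s.2 j) = x (s.2 j))
          (s \in agree x k C).
Proof.
rewrite inE; apply: (iffP forallP) => sP j.
  by move=> jk; have /implyP/(_ jk)/andP[? /eqP] := sP j.
by apply/implyP => /sP[-> ->]; rewrite eqxx.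
Qed.

(** The cells after [x], flipped on all [F j], has scored exactly [i]: positions before [i] avoid
    their [F j], position [i] lies in its own, and nothing is learnt about later ones. *)
Definition hit C F (i j : 'I_n) : {set 'I_n} :=
  if (j < i)%N then (C j :\: F j)%SET else if j == i then F j else C j.

Definition miss C F (j : 'I_n) : {set 'I_n} := (C j :\: F j)%SET.

Lemma sum_option (T : finType) (f : option T -> R) :
  \sum_k f k = f None + \sum_k f (Some k).
Proof.
rewrite ![index_enum _]unlock [Finite.enum]unlock /= big_cons big_map.
by rewrite [Finite.enum]unlock.
Qed.

(** As the cells are disjoint, flipping [x] on every [F j] at once makes position [j] wrong iff it
    lies in [F j]; a score [i < k] is thus the first hit. Scores of [k] or more are merged into one
    outcome, the miss. [Q] carries knowledge that the cells do not express. *)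
Lemma cost_prefix_query x k C F (Q : {set secret n}) (d : 'I_n -> R) e c :
    (k <= n)%N -> disjoint_cells k C -> (forall j : 'I_n, (j < k)%N ->
      F j \subset C j) ->
    (forall i : 'I_n, (i < k)%N ->
       cost (agree x k (hit C F i) :&: Q)%SET (d i)) ->
    cost (agree x k (miss C F) :&: Q)%SET e ->
    #|agree x k C :&: Q|%SET%:R + \sum_(i < n | (i < k)%N) d i + e <= c ->
  cost (agree x k C :&: Q)%SET c.
Proof.
move=> kn dC FC dP eP le_c.
pose y := flip x (\bigcup_(j : 'I_n | (j < k)%N) F j)%SET.
pose g s := [pick i : 'I_n | (i < k)%N && (val i == score s y)].
have match_y s (j : 'I_n) : s \in agree x k C -> (j < k)%N ->
    (s.1 (s.2 j) == y (s.2 j)) = (s.2 j \notin F j).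
  move=> /agreeP sC jk; have [sCj ->] := sC j jk; rewrite ffunE.
  have -> : (s.2 j \in \bigcup_(j :
    'I_n | (j < k)%N) F j)%SET = (s.2 j \in F j).
    apply/bigcupP/idP => [[i ik sFi]|]; last by exists j.
    have [ij|ij] := eqVneq i j; first by rewrite -ij in sFi *.
    by case: (dC i j ik jk ij (s.2 j)) => //; apply: (subsetP (FC i ik)).
  by case: (x _) (_ \in F j) => [] [].
apply: (@cost_query _ _ (option 'I_n) g y (fun o => if o is Some i then
          if (i < k)%N then d i else 0 else e)).
- by move=> s s' _ _ ss'; rewrite /g ss'.
- move=> [i|]; last first.
    apply: cost_sub eP; apply/subsetP => s /[!inE].
    case/andP=> /andP[sC sQ]; rewrite sQ andbT /g.
    case: pickP => // no_hit _.
    have score_k : (k <= score s y)%N.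
      rewrite leqNgt; apply/negP => lt_k.
      have lt_n : (score s y < n)%N by apply: leq_trans kn.
      by have /= := no_hit (Ordinal lt_n); rewrite lt_k eqxx.
    apply/forallP => j; apply/implyP => jk.
    have sA : s \in agree x k C by rewrite inE.
    move/agreeP: (sA) => /(_ j jk)[sCj ->]; rewrite eqxx andbT.
    move: score_k; rewrite leq_score // => /forallP/(_ j)/implyP/(_ jk).
    by rewrite match_y // /miss inE sCj andbT.
  have [ik|ik] := ltnP i k; last first.
    rewrite (_ : (_ :&: _)%SET = set0); first exact: cost0.
    apply/setP => s; rewrite !inE; apply/negbTE; rewrite negb_and orbC.
    rewrite /g; case: pickP => //= j /andP[jk _].
    by apply/orP; left; apply: contraTneq jk => -[->]; rewrite -leqNgt.
  apply: cost_sub (dP i ik); apply/subsetP => s /[!inE].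
  case/andP=> /andP[sC sQ]; rewrite sQ andbT /g.
  case: pickP => // i' /andP[_ /eqP si]; move=> /eqP[ii']; subst i'.
  have sA : s \in agree x k C by rewrite inE.
  have i_le : (i <= score s y)%N by rewrite si.
  have i_max : (i < score s y)%N = false by rewrite -si ltnn.
  apply/forallP => j; apply/implyP => jk.
  move/agreeP: (sA) => /(_ j jk)[sCj ->]; rewrite eqxx andbT /hit.
  have before (l : 'I_n) : (l < i)%N -> s.2 l \notin F l.
    move=> li; rewrite -match_y ?(ltn_trans li) //.
    by move: i_le; rewrite leq_score ?(ltnW (ltn_ord i)) // =>
      /forallP/(_ l)/implyP->.
  case: ltnP => [/before|_]; first by rewrite !inE sCj andbT.
  case: eqP => // ->; apply: contraFT i_max => sF.
  rewrite leq_score ?ltn_ord //; apply/forallP => l; apply/implyP.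
  rewrite ltnS leq_eqVlt => /orP[/eqP/val_inj->|li]; rewrite match_y //.
    exact: before.
  exact: ltn_trans ik.
- rewrite sum_option; apply: le_trans le_c.
  by rewrite -addrA lerD2l addrC lerD2 ?lexx //= [leRHS]big_mkcond.
Qed.

End States.

(** * Bisection *)

Section Search.
Variables (R : realType) (n : nat).
Local Open Scope ring_scope.
Implicit Types (A Q : {set secret n}) (x : query n) (s : secret n) (c : R).
Implicit Types (C : 'I_n -> {set 'I_n}) (P : {set 'I_n}) (k l : nat).
Implicit Types w : secret n -> R.

(** The budget [w] may depend on the secret, but only its total over [A] counts: a secret may exceed
    its share if others stay below theirs. *)
Definition solved A w := cost A (\sum_(s in A) w s).

Lemma solved_set0 w : solved finset.set0 w.
Proof. by apply: cost0; rewrite big_set0. Qed.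

Lemma solved_le A w w' : {in A, forall s, w s <= w' s} ->
  solved A w -> solved A w'.
Proof. by move=> ww'; apply: cost_le; apply: ler_sum. Qed.

Lemma sum_const_set A c : \sum_(s in A) c = #|A|%:R * c.
Proof. by rewrite sumr_const mulr_natl. Qed.

(* [h] is the unknown that the queries of the search bisect. *)
Lemma solved_search (T : finType) (h : secret n -> T) (f : T -> nat)
    (B0 : {set T}) A w :
    (forall (B G : {set T}) d1 d2, B \subset B0 ->
       cost (A :&: h @^-1: (B :&: G))%SET d1 ->
       cost (A :&: h @^-1: (B :\: G))%SET d2 ->
     cost (A :&: h @^-1: B)%SET (#|A :&: h @^-1: B|%SET%:R + d1 + d2 : R)) ->
    (forall B : {set T}, B \subset B0 -> {in B &, forall u v, f u = f v} ->
       solved (A :&: h @^-1: B)%SET w) ->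
  forall l a (B : {set T}), B \subset B0 ->
    {in B, forall v, (a <= f v < a + 2 ^ l)%N} ->
  solved (A :&: h @^-1: B)%SET (fun s => w s + l%:R).
Proof.
move=> split fP; elim=> [|l IH] a B BB0 fB.
  have w_w : {in (A :&: h @^-1: B)%SET, forall s, w s <= w s + 0%:R}.
    by move=> s _; rewrite addr0.
  apply: solved_le w_w _; apply: fP => // u v /fB + /fB.
  by rewrite expn0 addn1 !ltnS -!eqn_leq => /eqP <- /eqP <-.
(* [G] is the lower half of the range of [f]; one query decides between the halves and adds 1 to the
   budget of every secret. *)
pose G : {set T} := [set v | (f v < a + 2 ^ l)%N]%SET.
have BG : (B :&: G \subset B0)%SET by apply: subset_trans BB0; apply: subsetIl.
have BDG : (B :\: G \subset B0)%SET by apply: subset_trans BB0; apply: subsetDl.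
have c1 := IH a _ BG; have c2 := IH (a + 2 ^ l)%N _ BDG.
apply: cost_le (split B G _ _ BB0 (c1 _) (c2 _)); last first.
- by move=> v; rewrite !inE -leqNgt => /andP[? /fB]; rewrite expnS; lia.
- by move=> v; rewrite !inE => /andP[/fB]; lia.
have -> : (A :&: h @^-1: (B :&: G) = A :&: h @^-1: B :&: h @^-1: G)%SET.
  by apply/setP => s; rewrite !inE andbA.
have -> : (A :&: h @^-1: (B :\: G) = A :&: h @^-1: B :\: h @^-1: G)%SET.
  by apply/setP => s; rewrite !inE andbCA.
rewrite -addrA -(big_setID (h @^-1: G)%SET) /= big_split /= [leRHS]big_split /=.
by rewrite !sum_const_set -natr1 mulrDr mulr1 addrCA [in leRHS](addrC (_ * _)).
Qed.

(** A bisection down to single values: [f] is the index in an enumeration of [B]. *)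
Lemma solved_search1 (T : finType) (h : secret n -> T) (B : {set T}) A w l :
    (forall (B' G : {set T}) d1 d2, B' \subset B ->
       cost (A :&: h @^-1: (B' :&: G))%SET d1 ->
       cost (A :&: h @^-1: (B' :\: G))%SET d2 ->
     cost (A :&: h @^-1: B')%SET (#|A :&: h @^-1: B'|%SET%:R + d1 + d2 : R)) ->
    (#|B| <= 2 ^ l)%N ->
    {in B, forall v, solved (A :&: h @^-1: [set v])%SET w} ->
  solved (A :&: h @^-1: B)%SET (fun s => w s + l%:R).
Proof.
move=> split Bl Bw.
apply: (solved_search (f := fun v => index v (enum B)) split) 0%N _ _ _ => //.
  move=> B' B'B f_cst; have [->|[v vB']] := set_0Vmem B'.
    by rewrite preimset0 setI0; apply: solved_set0.
  have -> : B' = [set v]%SET.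
    apply/setP => u; rewrite !inE; apply/idP/eqP => [uB'|->//].
    by apply: (index_inj v _ _ (f_cst _ _ uB' vB'));
      rewrite mem_enum (subsetP B'B).
  by apply: Bw; apply: (subsetP B'B).
move=> v vB; rewrite /= add0n; apply: leq_trans Bl.
by rewrite cardE index_mem mem_enum.
Qed.

Definition upd C (j : 'I_n) P : 'I_n -> {set 'I_n} :=
  fun i => if i == j then P else C i.

Lemma eq_agree x k C C' : (forall j : 'I_n, (j < k)%N -> C j = C' j) ->
  agree x k C = agree x k C'.
Proof.
move=> CC'; apply/setP => s; rewrite !inE; apply: eq_forallb => j.
by case: (ltnP j k) => // /CC' ->.
Qed.

Lemma agree_sub x k C C' : (forall j : 'I_n, (j < k)%N -> C j \subset C' j) ->
  agree x k C \subset agree x k C'.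
Proof.
move=> CC'; apply/subsetP => s /agreeP sC; apply/agreeP => j jk.
by have [sj ->] := sC j jk; rewrite (subsetP (CC' j jk)).
Qed.

Lemma disjoint_cells_sub k C C' : (forall j : 'I_n, (j < k)%N ->
  C' j \subset C j) ->
  disjoint_cells k C -> disjoint_cells k C'.
Proof.
move=> C'C dC i j ik jk ij p pi pj.
by apply: (dC i j ik jk ij p);
  [apply: (subsetP (C'C i ik))|apply: (subsetP (C'C j jk))].
Qed.

Lemma upd_sub C j P : P \subset C j -> forall i, upd C j P i \subset C i.
Proof. by move=> PC i; rewrite /upd; case: eqP => [->|]. Qed.

Lemma agree_upd x k C (j : 'I_n) P : (j < k)%N -> P \subset C j ->
  agree x k (upd C j P) =
  (agree x k C :&: (fun s : secret n => s.2 j) @^-1: P)%SET.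
Proof.
move=> jk PC; apply/setP => s; rewrite in_setI; apply/agreeP/andP => [sU|].
  split; last by rewrite inE; have [] := sU j jk; rewrite /upd eqxx.
  apply: (subsetP (agree_sub _ _)); last by apply/agreeP; apply: sU.
  by move=> i _; apply: upd_sub.
case=> /agreeP sC; rewrite inE => sP i ik; have [? ->] := sC i ik.
by rewrite /upd; case: eqP => // ->.
Qed.

(** The prefix query whose only nonempty flipped set is [P] in cell [j]; the hit of [j] and the miss
    are the only possible outcomes. *)
Lemma cost_halve x k C (j : 'I_n) P Q d1 d2 : (k <= n)%N ->
  disjoint_cells k C ->
    (j < k)%N -> P \subset C j ->
    cost (agree x k (upd C j P) :&: Q)%SET d1 ->
    cost (agree x k (upd C j (C j :\: P)) :&: Q)%SET d2 ->
  cost (agree x k C :&: Q)%SET (#|agree x k C :&: Q|%SET%:R + d1 + d2 : R).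
Proof.
move=> kn dC jk PC c1 c2.
apply: (cost_prefix_query (F := fun i => if i == j then P else finset.set0)
          (d := fun i => if i == j then d1 else 0) (e := d2)) => //.
- by move=> i _; case: eqP => [->|]; rewrite ?sub0set.
- move=> i ik; case: eqP => [->|/eqP ij].
    rewrite (@eq_agree _ _ _ (upd C j P)) // => i' _; rewrite /hit /upd.
    by case: eqP => [->|_]; rewrite ?ltnn // setD0 if_same.
  rewrite (_ : _ :&: _ = finset.set0)%SET; first exact: cost0.
  apply/setP => s; rewrite !in_setI in_set0; apply/negbTE; rewrite negb_and.
  apply/orP; left; apply/negP => /agreeP/(_ i ik)[].
  by rewrite /hit ltnn eqxx (negbTE ij) inE.
- rewrite (@eq_agree _ _ _ (upd C j (C j :\: P)%SET)) // => i _.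
  by rewrite /miss /upd; case: eqP => [->//|]; rewrite setD0.
- rewrite -big_mkcondr /= (big_pred1 j) // => i /=.
  by case: eqP => [->|_]; rewrite ?andbF ?jk.
Qed.

(* Bisection of the candidate set of a position [j] of the prefix. *)
Lemma solved_resolve x k C (j : 'I_n) Q w l : (k <= n)%N ->
  disjoint_cells k C ->
    (j < k)%N -> (#|C j| <= 2 ^ l)%N ->
    {in C j, forall v, solved (agree x k (upd C j [set v]%SET) :&: Q)%SET w} ->
  solved (agree x k C :&: Q)%SET (fun s => w s + l%:R).
Proof.
move=> kn dC jk Cl Cw.
pose h (s : secret n) := s.2 j.
have eqI P : P \subset C j ->
    (agree x k C :&: Q :&: h @^-1: P = agree x k (upd C j P) :&: Q)%SET.
  by move=> PC; rewrite agree_upd // setIAC.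
have := @solved_search1 _ h (C j) (agree x k C :&: Q)%SET w l.
rewrite eqI // (@eq_agree _ _ (upd _ _ _) C) => [|i _]; last first.
  by rewrite /upd; case: eqP => [->|].
apply=> // [B G d1 d2 BC|v vC].
  have BG : (B :&: G \subset C j)%SET by apply: subset_trans BC;
    apply: subsetIl.
  have BDG : (B :\: G \subset C j)%SET by apply: subset_trans BC;
    apply: subsetDl.
  rewrite !eqI // => c1 c2;
    apply: (cost_halve (j := j) (P := (B :&: G)%SET)) => //.
  - by apply: disjoint_cells_sub dC => i _; apply: upd_sub.
  - by rewrite /upd eqxx subsetIl.
  - rewrite (@eq_agree _ _ _ (upd C j (B :&: G)%SET)) // => i _.
    by rewrite /upd; case: eqP.
  - rewrite (@eq_agree _ _ _ (upd C j (B :\: G)%SET)) // => i _.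
    by rewrite /upd eqxx; case: eqP => // _; rewrite setDIr setDv set0U.
by have := Cw v vC; rewrite -eqI ?sub1set.
Qed.

End Search.

(** * Locating the next position *)

Section Find.
Variables (R : realType) (n : nat).
Local Open Scope ring_scope.
Implicit Types (A Q : {set secret n}) (x : query n) (s : secret n) (c : R).
Implicit Types (C : 'I_n -> {set 'I_n}) (P F : {set 'I_n}) (k l : nat).
Implicit Types w : secret n -> R.

Definition pos (p : 'I_n) s := s.2 p.

Lemma in_preim (T : finType) (h : secret n -> T) (B : {set T}) s :
  (s \in h @^-1: B)%SET = (h s \in B).
Proof. by rewrite inE. Qed.

Definition off x (p : 'I_n) (e : bool) : {set secret n} :=
  [set s : secret n | (s.1 (s.2 p) != x (s.2 p)) == e]%SET.

(** Flipping [x] inside a clean set leaves the first [p] positions correct. *)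
Definition clean (p : 'I_n) C P :=
  forall j : 'I_n, (j < p)%N -> forall v, v \in C j -> v \notin P.

(** The first [p] positions are answered correctly for sure, so the score exceeds [p] iff the
    flipped query is also correct at position [p]. *)
Lemma cost_test x C (p : 'I_n) F A d1 d2 (M := off (flip x F) p false) :
    A \subset agree x p C -> clean p C F ->
    cost (A :&: M)%SET d1 -> cost (A :\: M)%SET d2 ->
  cost A (#|A|%:R + d1 + d2 : R).
Proof.
move=> AC FC c1 c2; pose g s := (p < score s (flip x F))%N.
have gM s : s \in A -> g s = (s \in M).
  move=> sA; rewrite /g leq_score // inE eqbF_neg negbK.
  apply/forallP/idP => [/(_ p)/implyP->//|sM j]; apply/implyP.
  rewrite ltnS leq_eqVlt => /orP[/eqP/val_inj->//|jp].
  have /agreeP/(_ j jp)[sj ->] := subsetP AC _ sA.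
  by rewrite ffunE (negbTE (FC j jp _ sj)) addbF.
apply: (@cost_query _ _ bool g (flip x F) (fun b => if b then d1 else d2)).
- by move=> s s' _ _ ss'; rewrite /g ss'.
- have cE b : (A :&: g @^-1: [set b])%SET =
              (if b then A :&: M else A :\: M)%SET.
    apply/setP => s; case: b; rewrite in_setI !inE; case sA: (s \in A);
      by rewrite ?andbF //= gM // inE ?eqb_id ?eqbF_neg ?andbT.
  by case; rewrite cE.
- by rewrite big_bool /= addrA.
Qed.

(** Once it is known whether [x] errs at position [p], a change of correctness after flipping [F]
    reveals whether that position lies in [F]. *)
Lemma cost_member x C (p : 'I_n) F A e d1 d2 :
    A \subset agree x p C -> A \subset off x p e -> clean p C F ->
    cost (A :&: pos p @^-1: F)%SET d1 -> cost (A :\: pos p @^-1: F)%SET d2 ->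
  cost A (#|A|%:R + d1 + d2 : R).
Proof.
move=> AC Ae FC c1 c2.
have sF s : s \in A -> (s \in off (flip x F) p false) = (pos p s \in F) (+) ~~
  e.
  move=> /(subsetP Ae); rewrite !inE ffunE /pos => /eqP <-.
  by case: (_ \in F) (x _) (s.1 _) => [] [] [].
have [eT|eF] := boolP e.
  apply: (cost_test AC FC); [apply: cost_sub c1|apply: cost_sub c2].
    by apply/subsetP => s; rewrite in_setI in_setI => /andP[sA];
      rewrite sF // sA eT /= addbF inE.
  by apply/subsetP => s; rewrite in_setD in_setD => /andP[+ sA];
    rewrite sF // sA eT /= addbF inE andbT.
rewrite addrAC; apply: (cost_test AC FC);
  [apply: cost_sub c2|apply: cost_sub c1].
  by apply/subsetP => s; rewrite in_setI in_setD => /andP[sA];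
    rewrite sF // sA eF /= addbT inE => ->.
by apply/subsetP => s; rewrite in_setD in_setI => /andP[+ sA];
  rewrite sF // sA eF /= addbT negbK inE.
Qed.

(** This is the splitting hypothesis of [solved_search] for the unknown [pos p]. *)
Lemma member_split x C (p : 'I_n) P A e : A \subset agree x p C ->
    A \subset off x p e -> clean p C P ->
  forall (B G : {set 'I_n}) d1 d2, B \subset P ->
    cost (A :&: pos p @^-1: (B :&: G))%SET d1 ->
    cost (A :&: pos p @^-1: (B :\: G))%SET d2 ->
  cost (A :&: pos p @^-1: B)%SET (#|A :&: pos p @^-1: B|%SET%:R + d1 + d2 : R).
Proof.
move=> AC Ae PC B G d1 d2 BP c1 c2.
have AB : (A :&: pos p @^-1: B)%SET \subset A by apply: subsetIl.
apply: (@cost_member x C p (B :&: G)%SET _ e).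
- exact: subset_trans AC.
- exact: subset_trans Ae.
- move=> j jp v vC; rewrite inE; apply: contra (PC j jp v vC) => /andP[+ _].
  exact: (subsetP BP).
- by apply: cost_sub c1; apply/subsetP => s;
  rewrite !inE => /andP[/andP[-> _] /andP[-> ->]].
- apply: cost_sub c2; apply/subsetP => s; rewrite !inE.
  by case/and3P => bg -> b; move: bg; rewrite b /= => ->.
Qed.

(* Once [pos p] is confined to [P], the prefix on which [x], flipped on [P] if
   need be, is correct extends to [p]. *)
Lemma agree_next x C (p : 'I_n) P e : clean p C P ->
  (agree x p C :&: off x p e :&: pos p @^-1: P)%SET =
  agree (if e then flip x P else x) p.+1 (upd C p P).
Proof.
move=> PC; apply/setP => s; apply/idP/agreeP => [|sA].
  rewrite !in_setI => /andP[/andP[/agreeP sC]]; rewrite !inE => /eqP se sP j.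
  rewrite ltnS leq_eqVlt /upd => /orP[/eqP/val_inj->|jp].
    rewrite eqxx; split=> //; move: se; case: e => /=; last first.
      by move/negbFE/eqP.
    by rewrite ffunE sP addbT; case: (x _) (s.1 _) => [] [].
  have [sj ->] := sC j jp; rewrite (negbTE (contra_neq _ (negbT (ltn_eqF jp)))).
    by case: e {se}; rewrite //= ffunE (negbTE (PC j jp _ sj)) addbF.
  by move=> ->.
have [] := sA p (ltnSn p); rewrite /upd eqxx => sP sx.
rewrite !in_setI !inE /pos sP andbT; apply/andP; split; last first.
  rewrite sx; case: e {sx sA}; rewrite /= ?eqxx // ffunE sP addbT.
  by case: (x _).
apply/forallP => j; apply/implyP => jp; have [] := sA j (ltnW jp).
rewrite /upd; case: eqP => [jp'|_]; first by rewrite jp' ltnn in jp.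
move=> sj ->; rewrite sj; case: e {sx sA}; rewrite /= ?eqxx // ffunE.
by rewrite (negbTE (PC j jp _ sj)) addbF eqxx.
Qed.

Lemma clean_sub (p : 'I_n) C P P' : P' \subset P -> clean p C P -> clean p C P'.
Proof. by move=> PP PC j jp v /(PC j jp); apply/contra/subsetP. Qed.

(* Number of cells of [js] that have been examined when that of [pos p s] is
   found. *)
Definition delay (p : 'I_n) C (js : seq 'I_n) s : nat :=
  (find (fun j => s.2 p \in C j) js).+1.

(** While position [j] may be anywhere in [C j], that cell cannot be flipped safely. So position [j]
    is first pinned down to a value [v] by [l] bisections; then the rest of [C j] is clean, and one
    query tests whether it contains position [p]. If so, [l] more bisections finish; otherwise the
    next cell of [js] is examined. *)
Lemma solved_collision x (p : 'I_n) e l (c : R) : (n <= 2 ^ l)%N ->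
  forall js C, disjoint_cells p C -> uniq js ->
    all (fun j : 'I_n => (j < p)%N) js ->
    (forall C' v, (forall j, C' j \subset C j) -> clean p C' [set v]%SET ->
       solved (agree x p C' :&: off x p e :&: pos p @^-1: [set v])%SET
              (fun=> c)) ->
  solved (agree x p C :&: off x p e :&: pos p @^-1: \bigcup_(j <- js) C j)%SET
         (fun s => c + ((delay p C js s) * l.+1 + l)%:R).
Proof.
move=> nl; elim=> [|j js IH] C dC;
  first by rewrite big_nil preimset0 setI0 => *; apply: solved_set0.
rewrite /= => /andP[j_js js_uniq] /andP[jp js_p] nextP.
have card_l P : (#|P| <= 2 ^ l)%N.
  by apply: leq_trans nl; rewrite -[n in (_ <= n)%N]card_ord max_card.
pose w s : R := c + ((find (fun j =>
  s.2 p \in C j) (j :: js)) * l.+1 + l.+1)%:R.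
rewrite -setIA; set Q := (off x p e :&: _)%SET.
apply: (@solved_le _ _ _ (fun s => w s + l%:R)).
  by move=> s _; rewrite /w /delay -addrA -natrD mulSn [(l.+1 + _)%N]addnC.
apply: (solved_resolve (j := j)) => // [|v vC]; first exact: ltnW.
pose C1 := upd C j [set v]%SET.
have C1C i : C1 i \subset C i by apply: upd_sub; rewrite sub1set.
have dC1 : disjoint_cells p C1 by apply: disjoint_cells_sub dC.
pose F := (C j :\ v)%SET.
have FC1 : clean p C1 F.
  move=> i ip u; rewrite /C1 /upd /F; case: eqP => [_|/eqP ij].
    by rewrite inE => /eqP ->; rewrite !inE eqxx.
  move=> uCi; rewrite !inE; apply/negP => /andP[_ uCj].
  exact: (dC i j ip jp ij u).
set A := (agree x p C1 :&: Q)%SET.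
have AC1 : A \subset agree x p C1 by apply: subsetIl.
have Ae : A \subset off x p e.
  by apply/subsetP => s; rewrite !in_setI => /and3P[].
have c1 : solved (A :&: pos p @^-1: F)%SET (fun s => c + l%:R).
  apply: (solved_search1 (member_split AC1 Ae FC1)) (card_l _) _.
  move=> u uF; have uC1 : clean p C1 [set u]%SET.
    by apply: clean_sub FC1; rewrite sub1set.
  have := nextP C1 u C1C uC1; rewrite /solved => cu.
  have -> : (A :&: pos p @^-1: [set u] =
          agree x p C1 :&: off x p e :&: pos p @^-1: [set u])%SET.
    apply/setP => s; rewrite !in_setI !in_preim in_set1 big_cons in_setU.
    have uC : u \in C j by move: uF; rewrite !inE => /andP[].
    case: eqP => [->|]; last by rewrite !andbF.
    by rewrite uC !andbT.
  by [].
have c2 : solved (A :\: pos p @^-1: F)%SET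
            (fun s => c + (delay p C1 js s * l.+1 + l)%:R).
  have -> : (A :\: pos p @^-1: F = agree x p C1 :&: off x p e :&:
               pos p @^-1: \bigcup_(i <- js) C1 i)%SET.
    apply/setP => s; rewrite in_setD !in_setI.
    case sC: (s \in agree _ _ _); rewrite ?andbF //=.
    case: (s \in off _ _ _); rewrite ?andbF //=.
    rewrite !in_preim big_cons in_setU in_setD in_set1 /pos.
    have sj : s.2 j = v.
      by move/agreeP: sC => /(_ j jp)[]; rewrite /C1 /upd eqxx inE => /eqP.
    (* The value [v] is taken by position [j], hence not by [p]: missing [F] means missing all of
       [C j]. *)
    have -> : (s.2 p == v) = false.
      by rewrite -sj; apply/eqP => /perm_inj pj; rewrite pj ltnn in jp.
    rewrite (eq_big_seq C1) => [|i ijs]; last first.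
      by rewrite /C1 /upd; case: eqP => // ij; rewrite -ij ijs in j_js.
    rewrite /=; case: (boolP (s.2 p \in C j)) => //= spC.
    apply/esym/negbTE/negP; rewrite (big_nth j) big_mkord => /bigcupP[i _].
    have ijs := mem_nth j (ltn_ord i).
    have /allP/(_ _ ijs) /= ip := js_p.
    rewrite /C1 /upd; case: eqP => [ij|/eqP ij spCi].
      by rewrite ij (negbTE j_js) in ijs.
    exact: (dC _ _ ip jp ij (s.2 p)).
  apply: IH => // C' u C'C; apply: nextP => i.
  exact: subset_trans (C1C i).
apply: cost_le (cost_member AC1 Ae FC1 c1 c2).
have spC s : s \in A -> s.2 p \in C j -> s.2 p \in F.
  rewrite in_setI => /andP[/agreeP/(_ j jp)[]]; rewrite /C1 /upd eqxx inE.
  move=> /eqP sj _ _ spC; rewrite !inE spC andbT -sj.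
  by apply/eqP => /perm_inj pj; rewrite pj ltnn in jp.
rewrite -(cardsID (pos p @^-1: F)%SET A) natrD -!sumr_const -addrA addrACA.
rewrite -!big_split /=.
rewrite [leRHS](big_setID (pos p @^-1: F)%SET) /= lerD // ler_sum // => s.
  move=> _; rewrite /w addrCA lerD2l nat1r ler_nat; exact: leq_addl.
rewrite in_setD in_preim /w /= => /andP[spF sA];
  have spC' := contra (spC s sA) spF.
rewrite (negbTE spC') addrCA lerD2l nat1r ler_nat -addnS leq_add2r.
rewrite leq_mul2r /delay ltnS; apply/orP; right.
apply: eq_leq; apply: eq_in_find => i ijs; rewrite /C1 /upd.
by case: eqP => // ij; rewrite -ij ijs in j_js.
Qed.

End Find.

(** * Counting secrets *)

Section Counting.
Variables (n : nat).
Local Open Scope nat_scope.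
Implicit Types (A Q : {set secret n}) (x : query n) (s : secret n).
Implicit Types (C F : 'I_n -> {set 'I_n}) (P : {set 'I_n}) (k l : nat).

(** Swapping positions [p] and [t >= p] does not touch the first [p] positions, so [v] is at least
    as frequent at [t] as at [p]; and [v] occurs at one position only. Hence position [p] takes the
    value [v] with probability at most [1/(n-p)]. *)
Lemma card_agree_pos x C (p v : 'I_n) :
  #|agree x p C :&: pos p @^-1: [set v]| * (n - p) <= #|agree x p C|.
Proof.
pose S t := (agree x p C :&: pos t @^-1: [set v])%SET.
have card_S (t : 'I_n) : p <= t -> #|S p| <= #|S t|.
  move=> pt; pose f s : secret n := (s.1, (tperm p t * s.2)%g).
  have f_inj : injective f by move=> [z q] [z' q'] [-> /mulgI ->].
  rewrite -(card_imset _ f_inj) subset_leq_card //.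
  apply/subsetP => _ /imsetP[s /setIP[/agreeP sC + ->]].
  rewrite in_setI !in_preim !in_set1 /pos /= permM tpermR => ->.
  rewrite andbT; apply/agreeP => j jp; rewrite permM /=.
  have pj : p != j by apply: contraTneq jp => ->; rewrite ltnn.
  have tj : t != j by apply: contraTneq jp => <-; rewrite -leqNgt.
  by rewrite tpermD //; apply: sC.
have -> : n - p = \sum_(t < n | p <= t) 1.
  by rewrite -[LHS]muln1 -sum_nat_const_nat big_geq_mkord.
rewrite big_distrr /= (card_fibers (fun s => (s.2^-1)%g v) (agree x p C)).
rewrite [leqRHS](bigID (fun t : 'I_n => p <= t)) /=.
apply: leq_trans (leq_addr _ _); apply: leq_sum => t pt.
rewrite muln1; apply: leq_trans (card_S t pt) _; apply: subset_leq_card.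
apply/subsetP => s; rewrite !in_setI !in_preim !in_set1 => /andP[-> /eqP <-].
by rewrite /pos permK eqxx.
Qed.

(** Swapping two values of one cell moves no other position of the prefix, as the cells are
    disjoint. *)
Lemma card_agree_upd1 x k C (j v v' : 'I_n) : disjoint_cells k C -> j < k ->
    v \in C j -> v' \in C j ->
  #|agree x k (upd C j [set v])| <= #|agree x k (upd C j [set v'])|.
Proof.
move=> dC jk vC vC'; pose t := tperm v v'.
(* The bit at [q] is chosen to differ from [x q] exactly when the old bit at [t q] differed from
   [x (t q)], which preserves the agreement with [x]. *)
pose f s : secret n :=
  ([ffun q => s.1 (t q) (+) x (t q) (+) x q], (s.2 * t)%g).
have f_inj : injective f.
  move=> [z q] [z' q'] [zz' /mulIg ->]; congr pair; apply/ffunP => i.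
  have /ffunP/(_ (t i)) := zz'; rewrite !ffunE tpermK.
  by move=> /addIb/addIb.
rewrite -(card_imset _ f_inj) subset_leq_card //.
apply/subsetP => _ /imsetP[s /agreeP sC ->]; apply/agreeP => i ik.
have [] := sC i ik; rewrite /f /= permM ffunE tpermK => + ->.
rewrite addbb addFb /upd; case: eqP => [_|/eqP ij si].
  by rewrite !in_set1 => /eqP ->; rewrite /t tpermL.
have neq u : u \in C j -> u != s.2 i.
  by move=> uC; apply/eqP => su; apply: (dC i j ik jk ij u); rewrite ?su // -su.
by rewrite /t tpermD ?neq.
Qed.

(** Position [j] is uniformly distributed over its cell, because by [card_agree_upd1] all values of
    the cell are equally frequent. *)
Lemma card_agree_upd x k C (j : 'I_n) P : disjoint_cells k C -> j < k ->
  P \subset C j ->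
  #|agree x k (upd C j P)| * #|C j| = #|agree x k C| * #|P|.
Proof.
move=> dC jk PC; have [C0|[v vC]] := set_0Vmem (C j).
  by move: PC; rewrite C0 subset0 => /eqP ->; rewrite !cards0 !muln0.
have cardE (G : {set 'I_n}) : G \subset C j ->
    #|agree x k (upd C j G)| = #|G| * #|agree x k (upd C j [set v])|.
  move=> GC; rewrite -sum_nat_const (card_fibers (pos j)) [RHS]big_mkcond /=.
  apply: eq_bigr => u _; rewrite agree_upd //.
  case: ifP => [uG|/negbT uG].
    have uC := subsetP GC _ uG.
    transitivity #|agree x k (upd C j [set u])|; last first.
      by apply/eqP; rewrite eqn_leq !(@card_agree_upd1 x k C j) //.
    rewrite agree_upd ?sub1set //; congr #|pred_of_set _|.
    apply/setP => s; rewrite !in_setI !in_preim in_set1.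
    by rewrite /pos; case: eqP => [->|]; rewrite ?uG ?andbF ?andbT.
  apply: eq_card0 => s; rewrite !in_setI !in_preim; apply/negbTE/negP.
  by rewrite in_set1 /pos => /andP[/andP[_ sG] /eqP su]; rewrite -su sG in uG.
rewrite cardE // -[in RHS](@eq_agree _ _ _ (upd C j (C j))).
  by rewrite (cardE (C j)) // mulnAC [_ * #|P|]mulnC mulnA.
by move=> i _; rewrite /upd; case: eqP => [->|].
Qed.

(** With [k+1] independent trials of success probability [1/(k+1)], all fail with probability at
    most 1/2; this follows from Bernoulli's inequality. *)
Lemma expn_miss k : 2 * k ^ k.+1 <= k.+1 ^ k.+1.
Proof.
have bernoulli m : k ^ m.+1 + m.+1 * k ^ m <= k.+1 ^ m.+1.
  elim: m => [|m IH]; first by rewrite !expn1 expn0; lia.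
  rewrite [in leqRHS]expnS; apply: leq_trans (leq_mul (leqnn _) IH).
  by rewrite [k ^ m.+2]expnS [k ^ m.+1]expnS; nia.
by apply: leq_trans (bernoulli k); rewrite expnS mulSn; nia.
Qed.

(** Cells are cut one at a time; by uniformity each cut keeps a share of at most [K/(K+1)]. *)
Lemma card_agree_miss x k C F K js : disjoint_cells k C -> uniq js ->
    (forall j : 'I_n, j \in js ->
      [/\ j < k, F j \subset C j & #|C j| <= K.+1 * #|F j|]) ->
  #|agree x k (fun j => if j \in js then C j :\: F j else C j)| * K.+1 ^ size js
    <= #|agree x k C| * K ^ size js.
Proof.
move=> dC; elim: js => [|j js IH] /=; first by rewrite !muln1.
case/andP=> j_js js_uniq jsP.
have [jk FC Fl] := jsP j (mem_head _ _).
have jsP' i : i \in js -> [/\ i < k, F i \subset C i & #|C i| <= K.+1 * #|F i|].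
  by move=> ijs; apply: jsP; rewrite inE ijs orbT.
pose D i := if i \in js then (C i :\: F i)%SET else C i.
have DC i : D i \subset C i by rewrite /D; case: ifP; rewrite ?subsetDl.
have dD : disjoint_cells k D by apply: disjoint_cells_sub dC.
have Dj : D j = C j by rewrite /D (negbTE j_js).
have := @card_agree_upd x k D j (C j :\: F j)%SET dD jk.
rewrite Dj subsetDl => /(_ isT) updE.
rewrite (@eq_agree _ _ _ _ (upd D j (C j :\: F j)%SET)) => [|i _]; last first.
  by rewrite inE /upd /D; case: eqP => [->|].
have {IH} := IH js_uniq jsP'; rewrite -/D => IH.
have [C0|Cj_gt0] := posnP #|C j|.
  rewrite (_ : #|_| = 0) // ; apply: eq_card0 => s;
    apply/negbTE/agreeP => /(_ j jk)[].
  by rewrite /upd eqxx inE (cards0_eq C0) inE andbF.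
have CF : #|C j :\: F j| * K.+1 <= #|C j| * K.
  by rewrite cardsDS // mulnBl leq_subLR mulnS leq_add2r mulnC.
rewrite -(leq_pmul2r Cj_gt0) mulnAC updE !expnS.
by have := leq_mul IH CF; congr (_ <= _); ring.
Qed.

End Counting.

(** * The moves *)

Section Steps.
Variables (R : realType) (n : nat).
Local Open Scope ring_scope.
Implicit Types (A Q : {set secret n}) (x : query n) (s : secret n) (c : R).
Implicit Types (C F : 'I_n -> {set 'I_n}) (P : {set 'I_n}) (k l : nat).
Implicit Types w : secret n -> R.

(** The outcomes are disjoint: of two of them, the one with the earlier hit, at [i] say, has
    position [i] in [F i], and the other has it outside. *)
Lemma card_prefix_query x k C F : (forall j : 'I_n, (j < k)%N ->
  F j \subset C j) ->
  (\sum_(i < n | i < k) #|agree x k (hit C F i)| + #|agree x k (miss C F)|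
     <= #|agree x k C|)%N.
Proof.
move=> FC; pose g s := [pick i :
  'I_n | (i < k)%N && (s \in agree x k (hit C F i))].
have hitC i : agree x k (hit C F i) \subset agree x k C.
  apply: agree_sub => j jk; rewrite /hit.
  by case: ifP => _; [apply: subsetDl|case: ifP => // _; apply: FC].
rewrite (card_fibers g (agree x k C)) [X in (_ <= X)%N](bigD1 None) //=.
rewrite addnC leq_add //.
  rewrite subset_leq_card //; apply/subsetP => s sM.
  rewrite in_setI in_preim in_set1; apply/andP; split.
    by apply: subsetP sM; apply: agree_sub => j jk; apply: subsetDl.
  rewrite /g; case: pickP => // i /andP[ik /agreeP/(_ i ik)[+ _]].
  rewrite /hit ltnn eqxx; move/agreeP: sM => /(_ i ik)[].
  by rewrite /miss inE => /andP[/negbTE->].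
rewrite (eq_bigl (fun o => isSome o)) => [|[]] //.
rewrite [X in (_ <= X)%N](reindex_omap Some id) => [|[]] //=.
rewrite big_mkcond [X in (_ <= X)%N]big_mkcond /=; apply: leq_sum => i _.
rewrite eqxx; case: ifP => // ik; apply: subset_leq_card.
apply/subsetP => s si; rewrite in_setI in_preim in_set1 (subsetP (hitC i)) //=.
rewrite /g; case: pickP => [i' /andP[i'k si']|/(_ i)]; last by rewrite ik si.
apply/eqP; congr Some; apply/val_inj.
move/agreeP: si; move/agreeP: si' => sa sb.
have [a1 _] := sa i ik; have [b1 _] := sb i ik.
have [a2 _] := sa i' i'k; have [b2 _] := sb i' i'k.
move: a1 b1 a2 b2; rewrite /hit !ltnn !eqxx; case: ltngtP => // _; rewrite !inE.
  by move=> /andP[/negbTE-> _].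
by move=> _ _ ->.
Qed.

(** At most half of the secrets miss. The others save 2 each, which pays on average for the one
    query asked. *)
Lemma cost_level x k C F (js : seq 'I_n) K (c : R) : (k <= n)%N ->
  disjoint_cells k C ->
    uniq js -> size js = K.+1 ->
    (forall j, j \in js ->
       [/\ (j < k)%N, F j \subset C j & (#|C j| <= K.+1 * #|F j|)%N]) ->
    (forall j, j \notin js -> F j = finset.set0) ->
    (forall i, i \in js -> solved (agree x k (hit C F i)) (fun=> c - 2)) ->
    solved (agree x k (miss C F)) (fun=> c) -> 2 <= c ->
  solved (agree x k C) (fun=> c).
Proof.
move=> kn dC js_uniq size_js jsP Fnjs hitP missP c2.
have FC j : F j \subset C j.
  by have [/jsP[]|/Fnjs->] := boolP (j \in js); rewrite ?sub0set.
have := card_prefix_query x (fun j (_ : (j < k)%N) => FC j).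
have := card_agree_miss x (F := F) dC js_uniq jsP.
rewrite size_js (@eq_agree _ _ _ _ (miss C F)) => [miss_le cards|j _];
  last first.
  by rewrite /miss; case: ifP => // /negbT/Fnjs ->; rewrite setD0.
have {miss_le} miss_le : (2 * #|agree x k (miss C F)| <= #|agree x k C|)%N.
  rewrite -(@leq_pmul2r (K.+1 ^ K.+1)) ?expn_gt0 // -mulnA.
  apply: leq_trans (leq_mul (leqnn 2) miss_le) _.
  by rewrite mulnCA leq_mul2l expn_miss orbT.
rewrite /solved -[agree x k C]setIT.
apply: (cost_prefix_query (F := F)
   (d := fun i => #|agree x k (hit C F i)|%:R * (c - 2))
   (e := #|agree x k (miss C F)|%:R * c)) => //.
- move=> i ik; rewrite setIT; have [/hitP|ijs] := boolP (i \in js).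
    by rewrite /solved sum_const_set.
  rewrite (_ : agree _ _ _ = finset.set0); first by rewrite cards0 mul0r;
    apply: cost0.
  apply/setP => s; rewrite in_set0; apply/negbTE/agreeP => /(_ i ik)[].
  by rewrite /hit ltnn eqxx Fnjs // inE.
- by move: missP; rewrite setIT /solved sum_const_set.
- rewrite setIT -mulr_suml -natr_sum sum_const_set.
  move: cards miss_le; set h := (\sum_(i < n | _) _)%N;
    set m := #|agree x k (miss C F)|.
  set a := #|agree x k C|; rewrite -!(ler_nat R) natrD natrM => hm ma.
  have : (h%:R + m%:R) * (c - 2) <= a%:R * (c - 2) by rewrite ler_wpM2r
    ?subr_ge0.
  lra.
Qed.

Lemma solved_resolve_all x k l (c : R) : (k <= n)%N -> (n <= 2 ^ l)%N ->
  forall js C, disjoint_cells k C -> all (fun j : 'I_n => (j < k)%N) js ->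
    (forall C', (forall j, C' j \subset C j) ->
       (forall j, j \in js -> (#|C' j| <= 1)%N) ->
       solved (agree x k C') (fun=> c)) ->
  solved (agree x k C) (fun=> c + (size js * l)%:R).
Proof.
move=> kn nl; elim=> [|j js IH] C dC.
  move=> _ /(_ C) cC; rewrite mul0n addr0; exact: cC.
move=> /= /andP[jk js_k] cC; rewrite mulSn addnC natrD addrA.
rewrite -[agree x k C]setIT; apply: (solved_resolve (j := j)) => // [|v vC].
  by apply: leq_trans nl; rewrite -[n in (_ <= n)%N]card_ord max_card.
have updC i : upd C j [set v]%SET i \subset C i by apply: upd_sub;
  rewrite sub1set.
rewrite setIT; apply: IH => // [|C' C'C js1];
  first by apply: disjoint_cells_sub dC.
apply: cC => [i|i]; first exact: subset_trans (updC i).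
rewrite inE => /orP[/eqP->|/js1 //].
by have := subset_leq_card (C'C j); rewrite /upd eqxx cards1.
Qed.

(** Asking [x] itself reveals whether it errs at position [p]; it is written as a flip on the empty
    set so that [cost_test] applies. *)
Lemma solved_off x C (p : 'I_n) w :
    (forall e, solved (agree x p C :&: off x p e)%SET w) ->
  solved (agree x p C) (fun s => w s + 1).
Proof.
move=> offP; have flip0 : flip x finset.set0 = x.
  by apply/ffunP => q; rewrite ffunE inE addbF.
have cF := offP false; rewrite -flip0 in cF.
have cT := offP true.
rewrite (_ : _ :&: _ = agree x p C :\: off (flip x finset.set0) p false)%SET in
  cT; last first.
  apply/setP => s; rewrite in_setI in_setD flip0 andbC; congr (_ && _).
  by rewrite !inE; case: (_ != _).
have := cost_test (fintype.subxx (mem (agree x p C))) _ _ cT.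
rewrite /solved; set A := agree x p C in cF cT *; rewrite flip0 in cF cT *.
have clean0 : clean p C finset.set0 by move=> j _ v _; rewrite inE.
move=> /(_ _ clean0 cF); apply: cost_le.
rewrite big_split /= sumr_const -addrA -(big_setID (off x p false)) /=.
by rewrite addrC.
Qed.

Definition outside (p : 'I_n) C : {set 'I_n} :=
  [set v | [forall j : 'I_n, (j < p)%N ==> (v \notin C j)]]%SET.

Lemma clean_outside (p : 'I_n) C : clean p C (outside p C).
Proof.
move=> j jp v vC; rewrite inE; apply/forallPn; exists j.
by rewrite jp /= vC.
Qed.

Lemma disjoint_cells_next C (p : 'I_n) P : disjoint_cells p C -> clean p C P ->
  disjoint_cells p.+1 (upd C p P).
Proof.
move=> dC PC i j ip jp ij v; rewrite /upd.
have lt_p (h : 'I_n) : (h < p.+1)%N -> h != p -> (h < p)%N.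
  by rewrite ltnS ltn_neqAle => -> ->.
have [ip'|/(lt_p i ip) {}ip] := eqVneq i p.
  case: eqP => [jp'|/eqP/(lt_p j jp) {}jp]; first by rewrite ip' jp' eqxx in ij.
  by move=> vP /(PC j jp); rewrite vP.
have [jp'|/(lt_p j jp) {}jp] := eqVneq j p; last exact: dC.
by move=> /(PC i ip)/negbTE->.
Qed.

(** When all cells are singletons, the next position lies outside of them, so their complement can
    be bisected. Each remaining position costs [l] bisections and one query for the correctness of
    [x]. *)
Lemma solved_singletons l : (n <= 2 ^ l)%N -> forall m k x C, (n - k = m)%N ->
    (k <= n)%N -> disjoint_cells k C -> (forall j : 'I_n, (j < k)%N ->
      (#|C j| <= 1)%N) ->
  solved (agree x k C) (fun=> (m * l.+1)%:R : R).
Proof.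
move=> nl; elim=> [|m IH] k x C km kn dC C1.
  apply: cost_leaf; last by rewrite big1.
  have {km kn} kn : k = n by apply/eqP; rewrite eqn_leq kn -subn_eq0 km eqxx.
  apply/card_le1_eqP => s s' /agreeP sC /agreeP s'C.
  have s2 : s.2 = s'.2.
    apply/permP => j; have jk : (j < k)%N by rewrite kn.
    have [sj _] := sC j jk; have [s'j _] := s'C j jk.
    exact: (card_le1_eqP (C1 j jk)).
  case: s s' s2 sC s'C => [z q] [z' q'] /= <- sC s'C; congr pair.
  apply/ffunP => v; have jk : ((q^-1)%g v < k)%N by rewrite kn.
  by have [_] := sC _ jk; have [_] := s'C _ jk; rewrite /= permKV => -> ->.
have kn' : (k < n)%N by rewrite -subn_gt0 km.
pose p := Ordinal kn'; rewrite -[k]/(val p).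
rewrite mulSn addSn -natr1 addnC; apply: solved_off => e.
have -> : (agree x p C :&: off x p e =
           agree x p C :&: off x p e :&: pos p @^-1: outside p C)%SET.
  apply/esym/setIidPl/subsetP => s /setIP[/agreeP sC _].
  rewrite in_preim inE; apply/forallP => j; apply/implyP => jp.
  apply/negP => spC; have [sj _] := sC j jp.
  have /perm_inj pj := card_le1_eqP (C1 j jp) _ _ spC sj.
  by rewrite -pj ltnn in jp.
rewrite natrD.
have AC : agree x p C :&: off x p e \subset agree x p C by apply: subsetIl.
have Ae : agree x p C :&: off x p e \subset off x p e by apply: subsetIr.
apply: (solved_search1 (member_split AC Ae (@clean_outside p C))).
  by apply: leq_trans nl; rewrite -[n in (_ <= n)%N]card_ord max_card.
move=> v vP; have cv : clean p C [set v]%SET.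
  by apply: clean_sub (@clean_outside p C); rewrite sub1set.
rewrite agree_next //; apply: IH => //; first by rewrite subnS km.
  exact: disjoint_cells_next.
move=> j; rewrite ltnS leq_eqVlt /upd => /orP[/eqP/val_inj->|jp].
  by rewrite eqxx cards1.
by case: eqP => _; [rewrite cards1|apply: C1].
Qed.

End Steps.

(** * The expected cost of a collision *)

Section Collisions.
Variables (R : realType) (n : nat).
Local Open Scope ring_scope.
Implicit Types (x : query n) (s : secret n) (C : 'I_n -> {set 'I_n}).

Lemma card_agree_pos_in x C (p : 'I_n) (P : {set 'I_n}) :
  (#|agree x p C :&: pos p @^-1: P|%SET * (n - p) <= #|P| * #|agree x p C|)%N.
Proof.
rewrite -[leqRHS]sum_nat_const (card_fibers (pos p)) big_distrl /=
  [leqRHS]big_mkcond /=.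
apply: leq_sum => v _; case: ifP => vP.
  apply: leq_trans (card_agree_pos x C p v);
    rewrite leq_mul2r subset_leq_card ?orbT //.
  by apply/subsetP => s; rewrite !in_setI => /andP[/andP[-> _] ->].
rewrite (_ : _ :&: _ = finset.set0)%SET ?cards0 //.
apply/setP => s; rewrite !in_setI !in_preim in_set1 in_set0.
by case: eqP => [->|]; rewrite ?vP ?andbF.
Qed.

Lemma sum_invsqr m : \sum_(i < m) (i.+1%:R ^+ 2)^-1 <= 2 :> R.
Proof.
case: m => [|m]; first by rewrite big_ord0.
(* The bound is strengthened to make the induction work. *)
apply: (@le_trans _ _ (2 - m.+1%:R^-1)); last by rewrite gerBl invr_ge0 ler0n.
elim: m => [|m IH]; first by rewrite big_ord_recr big_ord0 /= expr1n !invr1;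
  lra.
rewrite big_ord_recr /=; apply: le_trans (lerD IH (lexx _)) _.
have y0 : 0 < m.+1%:R :> R by rewrite ltr0n.
rewrite -[m.+2%:R]natr1; move: m.+1%:R y0 => y y0.
have -> : y^-1 = (y + 1)^-1 + ((y + 1) ^+ 2)^-1 + (y * (y + 1) ^+ 2)^-1.
  by field; rewrite !gt_eqF // addr_gt0.
have : 0 <= (y * (y + 1) ^+ 2)^-1.
  by rewrite invr_ge0 mulr_ge0 ?exprn_ge0 ?addr_ge0 ?ler01 ?ltW.
lra.
Qed.

(** Position [p] lies in the [i]-th cell with probability at most [L * #|Ci i| / n], at a cost of at
    most [3 * L * (i+1)]. The product is at most [3 / (i+1)^2], which is summable, provided that
    [#|Ci i| * (i+1)^3 * L^2 <= n]. *)
Lemma sum_delay x C (p : 'I_n) js L :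
    (n <= (n - p) * L)%N -> (0 < L)%N ->
    (forall i, nth 0 [seq #|C j| | j <- js] i * i.+1 ^ 4 <= n)%N ->
    (forall j, j \in js -> #|C j| * L ^ 8 <= n)%N ->
  \sum_(s in (agree x p C :&: pos p @^-1: \bigcup_(j <- js) C j)%SET)
     (delay p C js s * L.+1 + L)%:R <= 6 * #|agree x p C|%:R :> R.
Proof.
move=> npL L0 js4 jsL; set A := agree x p C.
pose Ci i := C (nth p js i).
pose t i := #|A :&: pos p @^-1: Ci i|%SET.
pose u i := (i.+1 * L.+1 + L)%N.
have n0 : (0 < n)%N by apply: leq_trans (ltn_ord p).
have t_le i : (i < size js)%N -> (t i * u i * i.+1 ^ 2 <= 3 * #|A|)%N.
  move=> ijs; rewrite -(leq_pmul2l n0).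
  have szE : nth 0%N [seq #|C j| | j <- js] i = #|Ci i| by rewrite (nth_map p).
  have sz4 := js4 i; rewrite szE in sz4.
  have szL := jsL _ (mem_nth p ijs); rewrite -/(Ci i) in szL.
  (* For [i+1 >= L^2] the fourth power in [js4] suffices; for smaller [i],
     [(i+1)^3 * L^2 <= L^8]. *)
  have sz : (#|Ci i| * (i.+1 ^ 3 * L ^ 2) <= n)%N.
    have [Li|iL] := leqP (L ^ 2) i.+1.
      by apply: leq_trans sz4;
        rewrite leq_mul2l [(i.+1 ^ 4)%N]expnSr leq_mul2l Li !orbT.
    apply: leq_trans szL; rewrite leq_mul2l -[8%N]/(2 * 3 + 2)%N expnD expnM.
    by rewrite leq_mul2r leq_exp2r // (ltnW iL) !orbT.
  have tA := card_agree_pos_in x C p (Ci i); rewrite -/(t i) -/A in tA.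
  have tn : (n * t i <= L * (#|Ci i| * #|A|))%N.
    apply: leq_trans (leq_mul npL (leqnn (t i))) _.
    by rewrite mulnAC mulnC leq_mul2l mulnC tA orbT.
  have u_le : (u i <= 3 * L * i.+1)%N.
    by rewrite /u; nia.
  apply: (@leq_trans (L * (#|Ci i| * #|A|) * (3 * L * i.+1) * i.+1 ^ 2)%N).
    by rewrite [(n * _)%N]mulnA leq_mul2r [(n * _)%N]mulnA leq_mul ?orbT.
  apply: (@leq_trans (3 * #|A| * (#|Ci i| * (i.+1 ^ 3 * L ^ 2)))%N).
    by apply: eq_leq; rewrite (expnS i.+1 2) (expnS L 1) expn1; ring.
  by rewrite mulnC leq_mul2r sz orbT.
apply: (@le_trans _ _ (\sum_(s in A) \sum_(i < size js)
          (if pos p s \in Ci i then (u i)%:R else 0))).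
  rewrite big_mkcond [leRHS]big_mkcond /=; apply: ler_sum => s _.
  rewrite in_setI in_preim; case: (s \in A) => //=; case: ifP => [sC|_];
    last first.
    by apply: sumr_ge0 => i _; case: ifP.
  have s_js : has (fun j => s.2 p \in C j) js.
    move: sC; rewrite (big_nth p) big_mkord => /bigcupP[i _ si].
    by apply/hasP; exists (nth p js i) => //; apply: mem_nth.
  have ijs : (find (fun j =>
    s.2 p \in C j) js < size js)%N by rewrite -has_find.
  rewrite (bigD1 (Ordinal ijs)) //= /Ci /pos (nth_find p s_js) lerDl.
  by apply: sumr_ge0 => i _; case: ifP.
rewrite exchange_big /=.
apply: (@le_trans _ _ (\sum_(i < size js) 3 * #|A|%:R * (i.+1%:R ^+ 2)^-1)).
  apply: ler_sum => i _; rewrite -big_mkcondr /= sumr_const.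
  rewrite ler_pdivlMr ?exprn_gt0 ?ltr0n // -[X in X * _]mulr_natl -natrX
    -!natrM ler_nat.
  apply: leq_trans (t_le i _) => //; rewrite !leq_mul2r; apply/orP; right.
  apply/orP; right; apply: subset_leq_card; apply/subsetP => s.
  by rewrite in_setI in_preim.
rewrite -mulr_sumr; have := sum_invsqr (size js).
have : 0 <= #|A|%:R :> R by rewrite ler0n.
move: (\sum_(i < _) _) (#|A|%:R) => S y; nra.
Qed.

End Collisions.

(** * The potential argument *)

Section Recursion.
Variables (R : realType) (n : nat).
Local Open Scope ring_scope.
Implicit Types (A Q : {set secret n}) (x : query n) (s : secret n).
Implicit Types (C F : 'I_n -> {set 'I_n}) (P : {set 'I_n}) (k : nat).

(** [L] bisections find a value among all [n], and [l] bisections lead to a cell of size at most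
    [M]. A cell of size [c] carries potential [phi c]. A position not yet found carries [G]: this
    pays [g] for its new cell, [l] bisections, and 8 for two tests and an expected collision cost of
    6. *)
Variables (L M l : nat) (phi : nat -> R) (g G : R).
Hypothesis nL : (n <= 2 ^ L)%N.
Hypothesis L0 : (0 < L)%N.
Hypothesis M0 : (0 < M)%N.
Hypothesis ML : (M * L ^ 8 <= n)%N.
Hypothesis Ml : (n <= M * 2 ^ l)%N.
Hypothesis phi_ge0 : forall c, 0 <= phi c.
Hypothesis phi_mono : forall c c' : nat, (c <= c' <= M)%N -> phi c <= phi c'.
Hypothesis phi_le : forall c, (c <= M)%N -> phi c <= g.
Hypothesis phi_gain : forall c K, (1 < c <= M)%N -> (n < c * K.+1 ^ 4)%N ->
  phi (c.-1 %/ K.+1).+1 + 2 <= phi c.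
Hypothesis gG : g + l%:R + 8 <= G.

(** The term [4 * n] is the reserve for the final phase, see [solved_last]. *)
Definition pot k C : R :=
  \sum_(j < n | (j < k)%N) phi #|C j| + (n - k)%:R * G + 4 * n%:R.

Lemma pot_le k C C' : (forall j : 'I_n, (j < k)%N ->
  (#|C' j| <= #|C j| <= M)%N) ->
  pot k C' <= pot k C.
Proof.
by move=> CC'; rewrite /pot !lerD2r ler_sum // => j jk; apply/phi_mono/CC'.
Qed.

Lemma pot_gain k C C' (i : 'I_n) c : (i < k)%N ->
  phi #|C' i| + c <= phi #|C i| ->
    (forall j : 'I_n, (j < k)%N -> (#|C' j| <= #|C j| <= M)%N) ->
  pot k C' <= pot k C - c.
Proof.
move=> ik i_gain CC'; rewrite lerBrDr /pot.
rewrite addrAC lerD2r addrAC lerD2r (bigD1 i) //= [leRHS](bigD1 i) //=.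
rewrite addrAC lerD // ler_sum // => j /andP[jk _]; exact/phi_mono/CC'.
Qed.

Lemma pot_next C C' (p : 'I_n) P : (#|P| <= M)%N ->
    (forall j : 'I_n, (j < p)%N -> (#|C' j| <= #|C j| <= M)%N) ->
  pot p.+1 (upd C' p P) <= pot p C + (g - G).
Proof.
move=> PM CC'; rewrite /pot.
have -> : (n - p)%:R = (n - p.+1)%:R + 1 :> R by rewrite natr1 subnSK.
rewrite (bigD1 p) //= /upd eqxx.
have : \sum_(i < n | (i < p.+1)%N && (i != p)) phi #|if i == p then P else C' i|
       <= \sum_(j < n | (j < p)%N) phi #|C j|.
  rewrite (eq_bigl (fun i : 'I_n => (i < p)%N)) => [|i]; last first.
    by rewrite ltnS -val_eqE andbC -ltn_neqAle.
  apply: ler_sum => j jp; rewrite -val_eqE (ltn_eqF jp); exact/phi_mono/CC'.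
have := phi_le PM; set S := \sum_(i < n | _) _; set S' := \sum_(i < n | _) _.
lra.
Qed.

Lemma card_take_enum P m : (m <= #|P|)%N ->
  #|[set v in take m (enum P)]%SET| = m.
Proof.
move=> mP; rewrite cardsE (card_uniqP _) ?take_uniq ?enum_uniq //.
by rewrite size_take_min -cardE; apply/minn_idPl.
Qed.

Lemma take_enum_sub P m : ([set v in take m (enum P)] \subset P)%SET.
Proof. by apply/subsetP => v; rewrite inE => /mem_take; rewrite mem_enum. Qed.

(** Decreasing sizes make entry [i] a lower bound on the sizes of the first [i+1] cells. *)
Definition unresolved k C : seq 'I_n :=
  sort (fun i j : 'I_n => #|C j| <= #|C i|)%N
       [seq j : 'I_n <- enum 'I_n | (j < k)%N && (1 < #|C j|)%N].

Lemma unresolved_uniq k C : uniq (unresolved k C).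
Proof. by rewrite sort_uniq filter_uniq ?enum_uniq. Qed.

Lemma mem_unresolved k C (j : 'I_n) :
  (j \in unresolved k C) = ((j < k) && (1 < #|C j|))%N.
Proof. by rewrite mem_sort mem_filter mem_enum andbT. Qed.

Lemma unresolved_nth k C i (j : 'I_n) : j \in take i.+1 (unresolved k C) ->
  (nth 0 [seq #|C j| | j <- unresolved k C] i <= #|C j|)%N.
Proof.
set js := unresolved k C => jT; have [ijs|ijs] := ltnP i (size js); last first.
  by rewrite nth_default // size_map.
rewrite (nth_map j) //; pose a := index j (take i.+1 js).
have aT : (a < size (take i.+1 js))%N by rewrite index_mem.
have ai : (a < i.+1)%N by apply: leq_trans aT _; rewrite size_take_min geq_minl.
have a_j : nth j js a = j by rewrite -(nth_take j ai) nth_index.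
have js_sorted : sorted (fun i j : 'I_n => #|C j| <= #|C i|)%N js.
  by apply: sort_sorted => i1 i2; apply: leq_total.
have trR : transitive (fun i j : 'I_n => #|C j| <= #|C i|)%N.
  by move=> i1 i2 i3 /[swap]; apply: leq_trans.
rewrite -[in leqRHS]a_j.
apply: (sorted_leq_nth trR (fun=> leqnn _) j js_sorted a i) => //.
by rewrite inE; apply: leq_ltn_trans ijs.
Qed.

Lemma sum_card_lt k C C' (i : 'I_n) : (i < k)%N -> (#|C' i| < #|C i|)%N ->
    (forall j : 'I_n, (j < k)%N -> (#|C' j| <= #|C j|)%N) ->
  (\sum_(j < n | j < k) #|C' j| < \sum_(j < n | j < k) #|C j|)%N.
Proof.
move=> ik i_lt CC'; rewrite (bigD1 i) //= [X in (_ < X)%N](bigD1 i) //=.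
by rewrite -addSn leq_add // leq_sum // => j /andP[jk _]; apply: CC'.
Qed.

Lemma n_gt0 : (0 < n)%N.
Proof. by apply: leq_trans ML; rewrite muln_gt0 M0 expn_gt0 L0. Qed.

Lemma pot_ge k C : 4 * n%:R <= pot k C.
Proof.
rewrite /pot lerDr addr_ge0 ?sumr_ge0 // mulr_ge0 //.
apply: le_trans gG; rewrite !addr_ge0 //.
exact: le_trans (phi_ge0 0%N) (phi_le (leq0n M)).
Qed.

(** The first [i+1] unresolved cells are all large, and [cost_level] applies to them. A hit gains 2
    by [phi_gain]; hit and miss both decrease the total size of the cells, the measure of the
    induction. *)
Lemma solved_level_step k x C i : (k <= n)%N -> disjoint_cells k C ->
    (forall j : 'I_n, (j < k)%N -> (#|C j| <= M)%N) ->
    (n < nth 0 [seq #|C j| | j <- unresolved k C] i * i.+1 ^ 4)%N ->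
    (forall C', (forall j, C' j \subset C j) ->
       (\sum_(j < n | j < k) #|C' j| < \sum_(j < n | j < k) #|C j|)%N ->
       solved (agree x k C') (fun=> pot k C')) ->
  solved (agree x k C) (fun=> pot k C).
Proof.
move=> kn dC CM big_i IH; set js := unresolved k C in big_i.
have ijs : (i < size js)%N.
  by rewrite ltnNge; apply: contraL big_i => ijs;
    rewrite nth_default ?size_map // ltn0.
pose T := take i.+1 js.
have T_uniq : uniq T by rewrite take_uniq ?unresolved_uniq.
have T_size : size T = i.+1 by rewrite size_takel.
have TP j : j \in T -> [/\ (j < k)%N, (1 < #|C j| <= M)%N & (n < #|C j| * i.+1
  ^ 4)%N].
  move=> jT; have := mem_take jT; rewrite mem_unresolved => /andP[jk ->].
  split=> //; first exact: CM.
  by apply: leq_trans big_i _; rewrite leq_mul2r unresolved_nth ?orbT.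
(* For [i = 0] the condition would read [n < #|C j|], against [#|C j| <= M <= n]. *)
have i0 j : j \in T -> (0 < i)%N.
  move=> /TP[_ /andP[_ jM]]; case: (i) => //; rewrite exp1n muln1 ltnNge.
  rewrite (leq_trans jM) //; apply: leq_trans ML.
  by rewrite leq_pmulr // expn_gt0 L0.
(* This is [#|C j| / (i+1)] rounded up. *)
pose m j := (#|C j|.-1 %/ i.+1).+1.
have m_lt j : j \in T -> (m j < #|C j|)%N.
  move=> jT; have [_ /andP[j1 _] _] := TP j jT.
  rewrite /m -[X in (_ < X)%N]prednK ?(ltn_trans _ j1) // ltnS ltn_Pdiv ?ltnS
    ?(i0 j) //.
  by rewrite -ltnS prednK // ltnW.
pose F j := if j \in T then [set v in take (m j) (enum (C j))]%SET else
  finset.set0.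
have FC j : F j \subset C j.
  by rewrite /F; case: ifP => _; rewrite ?sub0set ?take_enum_sub.
have F_card j : j \in T -> #|F j| = m j.
  by move=> jT; rewrite /F jT card_take_enum // ltnW // m_lt.
have hitC h j : hit C F h j \subset C j.
  by rewrite /hit; case: ifP => _; rewrite ?subsetDl //; case: ifP.
have missC j : miss C F j \subset C j by apply: subsetDl.
have subM C' : (forall j, C' j \subset C j) ->
    forall j : 'I_n, (j < k)%N -> (#|C' j| <= #|C j| <= M)%N.
  by move=> C'C j jk; rewrite subset_leq_card // CM.
apply: (cost_level (F := F) (js := T) (K := i)) => //.
- move=> j jT; have [jk j1 _] := TP j jT; split=> //; rewrite F_card //.
  by rewrite -[X in (X <= _)%N]prednK ?(leq_trans _ (andP j1).1) // mulnC
    ltn_ceil.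
- by move=> j jT; rewrite /F (negbTE jT).
- move=> h hT; have [hk h1 hn] := TP h hT.
  have hh : #|hit C F h h| = m h by rewrite /hit ltnn eqxx F_card.
  apply: solved_le (IH _ (hitC h) _); last first.
    apply: (sum_card_lt hk) => [|j jk]; first by rewrite hh m_lt.
    by apply: subset_leq_card.
  move=> s _; apply: (pot_gain hk); last exact: subM.
  by rewrite hh; apply: phi_gain.
- have jT : nth (Ordinal n_gt0) T 0 \in T by rewrite mem_nth // T_size.
  apply: solved_le (IH _ missC _); last first.
    have [jk _ _] := TP _ jT.
    apply: (sum_card_lt jk) => [|j' _]; last exact: subset_leq_card.
    rewrite /miss cardsDS // ltn_subrL F_card //=.
    by have [_ /andP[/ltnW]] := TP _ jT.
  by move=> s _; apply/pot_le/subM.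
- apply: le_trans (pot_ge k C).
  have : 1 <= n%:R :> R by rewrite ler1n n_gt0.
  lra.
Qed.

(** The last of [N] unresolved cells is nonempty, so [N^4 <= n]. This bounds [N * L] if [N >= L];
    otherwise [N * L <= L^2 <= L^8 <= n]. *)
Lemma size_unresolved k C :
    (forall i, nth 0 [seq #|C j| | j <- unresolved k C] i * i.+1 ^ 4 <= n)%N ->
  (size (unresolved k C) * L <= n)%N.
Proof.
set js := unresolved k C => js4.
case: (posnP (size js)) => [->|js0]; first by rewrite mul0n.
have i_js : ((size js).-1 < size js)%N by rewrite prednK.
have js_n : (size js ^ 4 <= n)%N.
  apply: leq_trans (js4 (size js).-1); rewrite prednK // leq_pmull //.
  rewrite (nth_map (Ordinal n_gt0)) //.
  have := mem_nth (Ordinal n_gt0) i_js; rewrite mem_unresolved.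
  by move=> /andP[_ /ltnW].
have [Ljs|Ljs] := leqP L (size js).
  apply: leq_trans js_n;
    rewrite (expnD _ 1 3) expn1 leq_mul2l (leq_trans Ljs) ?orbT //.
  by rewrite -[X in (X <= _)%N]expn1 leq_pexp2l.
apply: leq_trans ML; rewrite -[X in (X <= _)%N]mul1n leq_mul //.
apply: (@leq_trans (L ^ 2)%N);
  first by rewrite expnS expn1 leq_mul2r ltnW ?orbT.
by rewrite leq_pexp2l.
Qed.

(** Resolving all cells takes at most [n] queries, and the [n-k] remaining positions at most
    [2 * n], so the reserve suffices. *)
Lemma solved_last k x C : (k <= n)%N -> disjoint_cells k C ->
  ((n - k) * L <= n)%N ->
    (forall i, nth 0 [seq #|C j| | j <- unresolved k C] i * i.+1 ^ 4 <= n)%N ->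
  solved (agree x k C) (fun=> pot k C).
Proof.
move=> kn dC kL js4.
apply: (@solved_le _ _ _ (fun=> ((n - k) * L.+1)%:R + (size (unresolved k C) *
  L)%:R)).
  move=> s _; apply: le_trans (pot_ge k C); rewrite -natrD -natrM ler_nat.
  rewrite mulnS; have := size_unresolved js4; have := leq_subr k n; lia.
apply: solved_resolve_all => //.
  by apply/allP => j; rewrite mem_unresolved => /andP[].
move=> C' C'C js1; apply: solved_singletons => // [|j jk].
  by apply: disjoint_cells_sub dC => j _.
have [/js1//|] := boolP (j \in unresolved k C).
rewrite mem_unresolved jk /= -leqNgt; apply: leq_trans.
exact: subset_leq_card.
Qed.

Lemma card_block P : {in P &, forall u v : 'I_n, u %/ M = v %/ M}%N ->
  (#|P| <= M)%N.
Proof.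
move=> P_cst; have [->|[u uP]] := set_0Vmem P; first by rewrite cards0.
rewrite cardE -(size_map val) -(size_iota (u %/ M * M) M) uniq_leq_size //.
  by rewrite map_inj_uniq ?enum_uniq //; apply: val_inj.
move=> _ /mapP[v vP ->]; rewrite mem_enum in vP.
by rewrite mem_iota (P_cst u v) // leq_trunc_div -mulSnr ltn_ceil.
Qed.

(** One query tells whether [x] errs at [p], another whether position [p] is outside all cells. If
    it is, [l] bisections lead to a block of [M] consecutive values, the new cell; if not, the
    collision is resolved. *)
Lemma solved_next_step (p : 'I_n) x C : disjoint_cells p C ->
    (forall j : 'I_n, (j < p)%N -> (#|C j| <= M)%N) -> (n <= (n - p) * L)%N ->
    (forall i, nth 0 [seq #|C j| | j <- unresolved p C] i * i.+1 ^ 4 <= n)%N ->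
    (forall x' C', disjoint_cells p.+1 C' ->
       (forall j : 'I_n, (j < p.+1)%N -> (#|C' j| <= M)%N) ->
       solved (agree x' p.+1 C') (fun=> pot p.+1 C')) ->
  solved (agree x p C) (fun=> pot p C).
Proof.
move=> dC CM npL js4 IH; set js := unresolved p C in js4.
pose c := pot p C + (g - G).
have nextP e C' P : (forall j, C' j \subset C j) -> (#|P| <= M)%N ->
  clean p C' P ->
    solved (agree x p C' :&: off x p e :&: pos p @^-1: P)%SET (fun=> c).
  move=> C'C PM PC'; rewrite agree_next //.
  have C'M (j : 'I_n) : (j < p)%N -> (#|C' j| <= #|C j| <= M)%N.
    by move=> jp; rewrite subset_leq_card // CM.
  apply: solved_le (IH _ _ _ _).
  - by move=> s _; apply: pot_next.
  - by apply: disjoint_cells_next => //; apply: disjoint_cells_sub dC => j _.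
  - move=> j; rewrite ltnS leq_eqVlt /upd => /orP[/eqP/val_inj->|jp].
      by rewrite eqxx.
    case: eqP => // _; have /andP[] := C'M j jp; exact: leq_trans.
pose U := (\bigcup_(j <- js) C j)%SET.
pose u s : R := (delay p C js s * L.+1 + L)%:R.
(* The surcharge of a collision; it is unbounded for single secrets, and only its average is
   controlled, by [sum_delay]. *)
pose D s : R := if pos p s \in U then u s else 0.
have offP e : solved (agree x p C :&: off x p e)%SET (fun s =>
  c + l%:R + 1 + D s).
  set A := (agree x p C :&: off x p e)%SET.
  have AC : A \subset agree x p C by apply: subsetIl.
  have Ae : A \subset off x p e by apply: subsetIr.
  have RC := @clean_outside n p C.
  have c1 : solved (A :&: pos p @^-1: outside p C)%SET (fun s => c + l%:R).
    apply: (@solved_search _ _ _ (pos p) (fun v : 'I_n => v %/ M)%N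
              (outside p C) A (fun=> c) (member_split AC Ae RC) _ l 0%N) => //.
      move=> B BR B_cst; apply: nextP => //; first exact: card_block.
      exact: clean_sub RC.
    move=> v _; rewrite /= add0n ltn_divLR // mulnC.
    exact: leq_trans Ml.
  (* A cell with one element is filled by its own position, so position [p] can only be in an
     unresolved one. *)
  have UR s : s \in A -> (pos p s \in U) = (pos p s \notin outside p C).
    move=> sA; apply/idP/idP.
      rewrite /U (big_nth p) big_mkord => /bigcupP[i _ si].
      have := mem_nth p (ltn_ord i); rewrite mem_unresolved => /andP[jp _].
      by apply: contraTN si => sR; apply/negP => /(RC _ jp); rewrite sR.
    rewrite inE negb_forall => /existsP[j];
      rewrite negb_imply negbK => /andP[jp spC].
    have sC : s \in agree x p C by apply: (subsetP AC).
    have [sjC _] := agreeP _ _ _ _ sC j jp.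
    have jjs : j \in js.
      rewrite mem_unresolved jp /= ltnNge; apply/negP => /card_le1_eqP Cj1.
      have /perm_inj pj := Cj1 _ _ spC sjC.
      by rewrite -pj ltnn in jp.
    by rewrite /U (big_rem j) //= in_setU spC.
  have c2 : solved (A :\: pos p @^-1: outside p C)%SET (fun s => c + u s).
    have -> : (A :\: pos p @^-1: outside p C = A :&: pos p @^-1: U)%SET.
      apply/setP => s; rewrite in_setD in_setI !in_preim andbC.
      by case sA: (s \in A) => //=; rewrite UR.
    apply: solved_collision => //.
    - exact: unresolved_uniq.
    - by apply/allP => j; rewrite mem_unresolved => /andP[].
    - move=> C' v C'C cv; apply: nextP => //.
      by rewrite cards1.
  apply: cost_le (cost_member AC Ae RC c1 c2).
  rewrite -(cardsID (pos p @^-1: outside p C)%SET A) natrD -!sumr_const -addrA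
    addrACA.
  rewrite -!big_split /= [leRHS](big_setID (pos p @^-1: outside p C)%SET) /=.
  rewrite lerD // ler_sum // => s.
    move=> _; rewrite [1 + _]addrC lerDl /D; case: ifP => // _; exact: ler0n.
  rewrite in_setD in_preim => /andP[sR sA]; rewrite /D UR // sR.
  have := ler0n R l; lra.
apply: cost_le (solved_off offP); rewrite !big_split /= !sum_const_set.
have D_le : \sum_(s in agree x p C) D s <= 6 * #|agree x p C|%:R.
  apply: le_trans (sum_delay R x npL L0 js4 _); last first.
    move=> j; rewrite mem_unresolved => /andP[jp _].
    by apply: leq_trans ML; rewrite leq_mul2r CM ?orbT.
  rewrite big_mkcond [leRHS]big_mkcond /= ler_sum // => s _.
  by rewrite in_setI in_preim /D -/U; case: (s \in agree x p C).
move: D_le; rewrite /c; set a := #|agree x p C|%:R => D_le.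
have : 0 <= a * (G - (g + l%:R + 8)) by rewrite mulr_ge0 ?ler0n // subr_ge0.
lra.
Qed.

(** The outer induction is on the number of positions not yet located, the inner one on the total
    size of the cells. *)
Lemma solved_pot k x C : (k <= n)%N -> disjoint_cells k C ->
    (forall j : 'I_n, (j < k)%N -> (#|C j| <= M)%N) ->
  solved (agree x k C) (fun=> pot k C).
Proof.
have [m km] := ubnP (n - k)%N; elim: m => // m IHm in k x C km *.
have [t] := ubnP (\sum_(j < n | (j < k)%N) #|C j|)%N.
elim: t => // t IHt in x C * => Ct kn dC CM.
pose sz := [seq #|C j| | j <- unresolved k C].
have [/hasP[i _ big_i]|/hasPn/= small] :=
    boolP (has (fun i => n < nth 0 sz i * i.+1 ^ 4)%N (iota 0 (size sz))).
  apply: (solved_level_step kn dC CM big_i) => C' C'C C'lt.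
  apply: IHt => //; first exact: leq_trans C'lt _.
    by apply: disjoint_cells_sub dC => j _.
  by move=> j jk; apply: leq_trans (CM j jk); apply: subset_leq_card.
have js4 i : (nth 0 sz i * i.+1 ^ 4 <= n)%N.
  (* Past the end of the list the default size 0 satisfies the bound. *)
  have [szi|szi] := leqP (size sz) i; first by rewrite nth_default.
  by rewrite leqNgt small // mem_iota.
have [npL|npL] := leqP n ((n - k) * L)%N; last by apply: solved_last => //;
  apply: ltnW.
have lt_kn : (k < n)%N.
  by rewrite -subn_gt0; move: (leq_trans n_gt0 npL);
    rewrite muln_gt0 => /andP[].
apply: (@solved_next_step (Ordinal lt_kn)) => // x' C' dC' C'M;
  apply: IHm => //.
by move: km; rewrite /= ltnS; apply: leq_trans; rewrite ltn_sub2l.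
Qed.

Lemma solved_setT : solved [set: secret n]%SET (fun=> n%:R * (G + 4)).
Proof.
have triv0 : disjoint_cells 0 (fun=> finset.set0 : {set 'I_n}) by [].
have := @solved_pot 0 [ffun=> false] _ (leq0n n) triv0.
rewrite (_ : agree _ _ _ = [set: secret n]%SET); last first.
  by apply/setP => s; rewrite in_setT; apply/agreeP.
move=> potP; apply: solved_le (potP _) => // s _.
by rewrite /pot big_pred0 // add0r subn0 mulrDr [4 * _]mulrC.
Qed.

End Recursion.

(** * The potential function and the choice of parameters *)

Section Numerics.
Variable R : realType.
Local Open Scope ring_scope.
Implicit Types (x y : R) (n c k L M lam : nat).

Lemma ln_ge1BV x : 0 < x -> 1 - x^-1 <= ln x.
Proof.
move=> x0; rewrite -[x in ln x]invrK lnV ?posrE ?invr_gt0 // lerNr opprB.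
have := @le_ln1Dx R (x^-1 - 1); rewrite addrCA subrr addr0; apply.
by rewrite ltrBrDl subrr invr_gt0.
Qed.

Lemma ln2_ge : 1 / 2 <= ln 2 :> R.
Proof. by have := @ln_ge1BV 2; lra. Qed.

Lemma ln_expn2 k : k%:R / 2 <= ln (2 ^ k)%:R :> R.
Proof.
rewrite natrX lnXn // -[ln 2 *+ k]mulr_natl ler_wpM2l //; have := ln2_ge; lra.
Qed.

Definition log_gap n c : R := ln (ln n%:R) - ln (ln (n%:R / c%:R)).

(* When [n / c < k ^ 4], shrinking a cell of size [c] by a factor [k / 2] raises
   [ln (n / c)] by a factor at least 9/8, whence the gain of a constant.  All
   cells have size at most [M]; the cap only makes the bounds hold for all [c].
*)
Definition cell_pot n M c : R :=
  if (c <= 1)%N then 0 else 18 * (1 + log_gap n (minn c M)).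

Section Bounds.
Variables n L M : nat.
Hypothesis L1 : (1 < L)%N.
Hypothesis M0 : (0 < M)%N.
Hypothesis ML : (M * L ^ 8 <= n)%N.

Lemma ratio_ge c : (0 < c <= M)%N -> L%:R ^+ 8 <= n%:R / c%:R :> R.
Proof.
move=> /andP[c0 cM]; rewrite ler_pdivlMr ?ltr0n // -natrX -natrM ler_nat.
by apply: leq_trans ML; rewrite mulnC leq_mul2r cM orbT.
Qed.

Lemma ln_ratio_ge1 c : (0 < c <= M)%N -> 1 <= ln (n%:R / c%:R) :> R.
Proof.
move=> /ratio_ge le_r.
have r0 : 0 < n%:R / c%:R :> R.
  by apply: lt_le_trans le_r; rewrite exprn_gt0 // ltr0n ltnW.
apply: (@le_trans _ _ (ln (2 ^ 8)%:R)).
  by apply: le_trans (ln_expn2 8); lra.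
rewrite ler_ln ?posrE ?ltr0n // ?expn_gt0 //; apply: le_trans le_r.
by rewrite -natrX ler_nat leq_exp2r.
Qed.

Lemma log_gap_ge0 c : (0 < c <= M)%N -> 0 <= log_gap n c.
Proof.
move=> cM; have := ln_ratio_ge1 cM; rewrite /log_gap subr_ge0 => ln1.
have c0 : 0 < c%:R :> R by rewrite ltr0n; case/andP: cM.
have n0 : 0 < n%:R :> R.
  by rewrite ltr0n; apply: leq_trans ML; rewrite muln_gt0 M0 expn_gt0 ltnW.
have lnn : ln (n%:R / c%:R) <= ln n%:R :> R.
  rewrite ler_ln ?posrE ?divr_gt0 // ler_pdivrMr // -natrM ler_nat.
  by rewrite leq_pmulr // -(ltr0n R).
by rewrite ler_ln ?posrE //; lra.
Qed.

Lemma log_gap_mono c c' : (0 < c)%N -> (c <= c' <= M)%N ->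
  log_gap n c <= log_gap n c'.
Proof.
move=> c0 /andP[cc' c'M]; rewrite /log_gap lerD2l lerN2.
have c'0 : (0 < c')%N by apply: leq_trans cc'.
have h : 1 <= ln (n%:R / c%:R) :> R by apply: ln_ratio_ge1;
  rewrite c0 (leq_trans cc').
have h' : 1 <= ln (n%:R / c'%:R) :> R by apply: ln_ratio_ge1; rewrite c'0.
rewrite ler_ln ?posrE; [|lra|lra].
have n0 : (0 < n)%N by apply: leq_trans ML; rewrite muln_gt0 M0 expn_gt0 ltnW.
rewrite ler_ln ?posrE ?divr_gt0 ?ltr0n //.
by rewrite ler_pM2l ?ltr0n // lef_pV2 ?posrE ?ltr0n // ler_nat.
Qed.

Lemma minnM c : (1 < c)%N -> (0 < minn c M <= M)%N.
Proof. by move=> c1; rewrite leq_min (ltnW c1) M0 geq_minr. Qed.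

Lemma cell_pot_ge0 c : 0 <= cell_pot n M c.
Proof.
rewrite /cell_pot; case: leqP => // c1; have := log_gap_ge0 (minnM c1); lra.
Qed.

Lemma cell_pot_mono c c' : (c <= c' <= M)%N ->
  cell_pot n M c <= cell_pot n M c'.
Proof.
move=> /andP[cc' c'M]; rewrite {1}/cell_pot; case: leqP => [_|c1].
  exact: cell_pot_ge0.
rewrite /cell_pot leqNgt (leq_trans c1 cc') /=.
rewrite (minn_idPl c'M) (minn_idPl (leq_trans cc' c'M)).
have := @log_gap_mono c c' (ltnW c1); rewrite cc' c'M => /(_ isT); lra.
Qed.

Lemma cell_pot_le c : cell_pot n M c <= 18 * (1 + ln (ln n%:R)).
Proof.
have lnln c' : (0 < c' <= M)%N -> log_gap n c' <= ln (ln n%:R).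
  by move=> c'M; rewrite /log_gap gerBl ln_ge0 // ln_ratio_ge1.
rewrite /cell_pot; case: leqP => c1; last by have := lnln _ (minnM c1); lra.
have M1 : (0 < 1 <= M)%N by rewrite M0.
by have := le_trans (log_gap_ge0 M1) (lnln _ M1); lra.
Qed.

(** Write [x] for [ln (n/c)] and [x'] for its value at the new size. The shrinkage gives
    [x' >= x + ln k - ln 2], where [ln 2] is at most half of [ln k], and [x <= 4 * ln k]; so
    [x' >= 9/8 * x]. Finally [ln (9/8) >= 1/9], and the factor 18 turns this into 2. *)
Lemma cell_pot_gain c K : (1 < c <= M)%N -> (n < c * K.+1 ^ 4)%N ->
  cell_pot n M (c.-1 %/ K.+1).+1 + 2 <= cell_pot n M c.
Proof.
move=> /andP[c1 cM] big_c; set k := K.+1 in big_c *; set c' := (_ %/ _).+1.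
have c0 := ltnW c1; have cM' : (0 < c <= M)%N by rewrite c0.
rewrite {2}/cell_pot leqNgt c1 /= (minn_idPl cM).
(* A cell reduced to a single value loses its whole potential, at least 18. *)
rewrite /cell_pot; have [c'1|c'1] := leqP c' 1.
  by have := log_gap_ge0 cM'; lra.
have k0 : (0 < k)%N by [].
(* Since [c' >= 2], rounding up at most doubles the quotient. *)
have c'c : (c' * k <= 2 * c)%N.
  have : (c.-1 %/ k * k <= c.-1)%N := leq_trunc_div _ _.
  have : (k <= c.-1 %/ k * k)%N by rewrite leq_pmull.
  rewrite /c' mulSn; have := leq_pred c; lia.
(* For [k < 4], [c * k^4 <= M * 2^8 <= M * L^8 <= n]. *)
have k4 : (4 <= k)%N.
  rewrite leqNgt; apply/negP => k_lt4.
  have : (c * k ^ 4 <= n)%N.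
    apply: leq_trans ML; rewrite leq_mul //.
    apply: (@leq_trans (2 ^ 8)%N); last by rewrite leq_exp2r.
    by rewrite (expnM 2 2 4) leq_exp2r // ltnW.
  by rewrite leqNgt big_c.
have c'_le : (c' <= c)%N.
  by rewrite -(leq_pmul2r (isT :
    (0 < 2)%N)) [(c * 2)%N]mulnC (leq_trans _ c'c) // leq_mul2l (leq_trans _
      k4) ?orbT.
rewrite (minn_idPl (leq_trans c'_le cM)).
suff : log_gap n c' + 1 / 9 <= log_gap n c by lra.
rewrite /log_gap; set x := ln (n%:R / c%:R); set x' := ln (n%:R / c'%:R).
have x1 : 1 <= x by apply: ln_ratio_ge1.
suff xx' : 9 / 8 * x <= x'.
  have : ln (9 / 8 * x) <= ln x' by rewrite ler_ln ?posrE; lra.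
  rewrite lnM ?posrE; [|lra|lra]; have := @ln_ge1BV (9 / 8).
  rewrite -[(9 / 8)^-1]/(9 / 8)^-1 invf_div; lra.
have n0 : (0 < n)%N by apply: leq_trans ML; rewrite muln_gt0 M0 expn_gt0 ltnW.
have [kR cR nR c'R] : [/\ 0 < k%:R :> R, 0 < c%:R :> R, 0 < n%:R :> R & 0 <
  c'%:R :> R].
  by rewrite !ltr0n.
have x_k : x <= ln k%:R *+ 4.
  rewrite -lnXn // ler_ln ?posrE ?divr_gt0 ?exprn_gt0 // ler_pdivrMr //.
  by rewrite -natrX -natrM ler_nat mulnC ltnW.
have x'_k : x + (ln k%:R - ln 2) <= x'.
  rewrite -ln_div ?posrE // -lnM ?posrE ?divr_gt0 //.
  rewrite ler_ln ?posrE ?mulr_gt0 ?divr_gt0 ?invr_gt0 //.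
  rewrite ler_pdivlMr //.
  have -> : n%:R / c%:R * (k%:R / 2) * c'%:R = n%:R * ((c' * k)%:R / (2 *
    c)%:R) :> R.
    by rewrite !natrM; field; rewrite gt_eqF.
  rewrite -[leRHS]mulr1 ler_pM2l // ler_pdivrMr ?ltr0n ?muln_gt0 //.
  by rewrite mul1r ler_nat.
have ln_k : ln 2 *+ 2 <= ln k%:R :> R.
  by rewrite -lnXn // ler_ln ?posrE ?exprn_gt0 // -natrX ler_nat.
lra.
Qed.

End Bounds.

Lemma leq_expn2_linear lam : (7 <= lam)%N -> (8 * lam <= 2 ^ lam.-1)%N.
Proof.
move=> /subnKC <-; elim: (lam - 7)%N => // k IH.
by rewrite addnS -pred_Sn -[(7 + k)%N]prednK // expnS; move: IH; lia.
Qed.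

(** Cells start with about [n / (log n)^8] values, so finding one takes [8 * lam + 1] bisections,
    where [lam] is about [log log n]. The threshold on [n] ensures [lam >= 7]; the constant 1000 is
    generous. *)
Lemma cost_setT : exists C n0, forall n, (n0 <= n)%N ->
  cost [set: secret n]%SET (#|{: secret n}|%:R * (C * n%:R * ln (ln n%:R)) : R).
Proof.
exists 1000; exists (2 ^ 2 ^ 7)%N => n n_large.
set L := up_log 2 n; set lam := up_log 2 L.
have L_large : (2 ^ 7 <= L)%N by rewrite -(up_expnK (2 ^ 7) (isT :
  1 < 2)%N) leq_up_log.
have lam7 : (7 <= lam)%N by rewrite -(up_expnK 7 (isT : 1 < 2)%N) leq_up_log.
have L1 : (1 < L)%N by apply: leq_trans L_large.
have n1 : (1 < n)%N by apply: leq_trans n_large;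
  rewrite -[1%N]/(2 ^ 0)%N ltn_exp2l // expn_gt0.
have /andP[n_gt n_le] := up_log_bounds (isT : 1 < 2)%N n1.
have /andP[L_gt L_le] := up_log_bounds (isT : 1 < 2)%N L1.
rewrite -/L in n_gt n_le; rewrite -/lam in L_gt L_le.
have L8_le : (L ^ 8 <= 2 ^ (8 * lam))%N.
  by rewrite mulnC expnM leq_exp2r.
have L8n : (L ^ 8 <= n)%N.
  apply: leq_trans L8_le _; apply: leq_trans (ltnW n_gt).
  rewrite leq_exp2l //; apply: leq_trans (leq_expn2_linear lam7) _.
  by rewrite -ltnS prednK // ltnW.
set M := (n %/ L ^ 8)%N.
have L8_gt0 : (0 < L ^ 8)%N by rewrite expn_gt0 ltnW.
have M0 : (0 < M)%N by rewrite divn_gt0.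
have ML : (M * L ^ 8 <= n)%N by apply: leq_trunc_div.
have Ml : (n <= M * 2 ^ (8 * lam).+1)%N.
  apply: leq_trans (ltnW (ltn_ceil n L8_gt0)) _; rewrite -/M.
  apply: (@leq_trans (2 * M * L ^ 8)%N); first by rewrite leq_mul2r; lia.
  by rewrite (expnS 2) mulnCA -mulnA leq_mul2l leq_mul2l L8_le !orbT.
pose X : R := ln (ln n%:R).
pose G : R := 18 * (1 + X) + (8 * lam).+1%:R + 8.
have := @solved_setT R n L M (8 * lam).+1 (cell_pot n M) (18 * (1 + X)) G n_le
  (ltnW L1) M0 ML Ml (cell_pot_ge0 L1 M0 ML) (cell_pot_mono L1 M0 ML)
  (fun c _ => cell_pot_le L1 M0 ML c) (cell_pot_gain L1 M0 ML) (lexx _).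
apply: cost_le; rewrite sum_const_set cardsT ler_wpM2l //.
rewrite mulrAC [leRHS]mulrC ler_wpM2l // -/X /G.
(* Taking logarithms once more yields [lam <= 2 * X + 3]: the number of bisections is
   [O(ln ln n)]. *)
have lnn : (2 ^ (lam - 3))%:R <= ln n%:R :> R.
  apply: (@le_trans _ _ (ln (2 ^ L.-1)%:R)); last first.
    by rewrite ler_ln ?posrE ?ltr0n ?expn_gt0 ?(ltnW n1) // ler_nat ltnW.
  apply: le_trans (ln_expn2 _); rewrite ler_pdivlMr // -natrM ler_nat.
  rewrite -ltnS prednK ?(ltnW L1) //; apply: leq_ltn_trans L_gt.
  by rewrite -expnSr leq_exp2l //; lia.
have X_ge : (lam - 3)%:R / 2 <= X.
  apply: le_trans (ln_expn2 _) _; rewrite ler_ln ?posrE ?ltr0n ?expn_gt0 //.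
  by apply: lt_le_trans lnn; rewrite ltr0n expn_gt0.
rewrite natrB ?(leq_trans _ lam7) // in X_ge.
have : 7 <= lam%:R :> R by rewrite (ler_nat _ 7).
have -> : (8 * lam).+1%:R = 8 * lam%:R + 1 :> R by rewrite -natr1 natrM.
move: X_ge; move: (lam%:R) (X) => u v; clear; lra.
Qed.

End Numerics.

(** * Relabelling *)

Section Strategies.
Variables (R : realType) (n : nat).
Implicit Types (A : {set secret n}) (x : query n) (s g : secret n).
Implicit Types (T : strategy n) (t : nat) (h : seq (query n * 'I_n.+1)).

(** Transcripts grow at the end, whereas [cost] recurses from the root; this peels off the first
    query. *)
Lemma transcript_cons T s t x : T [::] = Some x ->
  transcript T s t.+1 =
  omap (cons (x, score s x)) (transcript (fun v => T (score s x :: v)) s t).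
Proof.
move=> Tx; elim: t => [|t IH]; first by rewrite /= Tx.
rewrite [LHS]/= -/(transcript T s t.+1) IH /=.
by case: (transcript _ s t) => //= h; case: (T _).
Qed.

Lemma transcript_consistent T s t h : transcript T s t = Some h ->
  s \in consistent h.
Proof.
elim: t h => [|t IH] h /=; first by case=> <-; rewrite inE.
case: (transcript T s t) IH => // h' /(_ _ erefl); rewrite inE => h'P.
by case: (T _) => // x [<-]; rewrite inE all_rcons /= eqxx.
Qed.

(** The derivation of [cost A c] is turned into a tree; [tau s] is the depth of the leaf that [s]
    reaches. *)
Lemma cost_strategy A (c : R) : cost A c ->
  exists T (tau : secret n -> nat),
    (forall s, s \in A -> exists2 h, transcript T s (tau s) = Some h &
       (#|A :&: consistent h| <= 1)%N) /\
    (\sum_(s in A) (tau s)%:R <= c)%R.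
Proof.
elim=> {A c} [A c A1 c0|A x d c _ IH Ac].
  exists (fun=> None), (fun=> 0%N); split; last by rewrite big1.
  move=> s sA; exists [::] => //; apply: leq_trans A1.
  by rewrite subset_leq_card // subsetIl.
have /choice[T TP] := IH; have {TP} /choice[tau tauP] := TP.
exists (fun v => if v is i :: v' then T i v' else Some x).
exists (fun s => (tau (score s x) s).+1); split.
  move=> s sA; have sAi : s \in A :&: [set s' | score s' x == score s x].
    by rewrite !inE sA eqxx.
  have [h Th h1] := (tauP (score s x)).1 s sAi.
  exists ((x, score s x) :: h).
    by rewrite (transcript_cons _ _ (x := x)) //= Th.
  apply: leq_trans h1; apply/subset_leq_card/subsetP => s'.
  by rewrite !inE /= => /and3P[-> -> ->].
apply: le_trans Ac; rewrite (partition_big (fun s => score s x) xpredT) //=.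
rewrite [in leRHS](card_fibers (fun s => score s x)) natr_sum -big_split /=.
apply: ler_sum => i _; rewrite -sumr_const.
apply: le_trans (lerD (lexx _) (tauP i).2).
rewrite (eq_bigl (mem (A :&: (fun s => score s x) @^-1: [set i]))); last first.
  by move=> s; rewrite !inE.
rewrite [X in (_ <= _ + X)%R](eq_bigl (mem (A :&: (fun s =>
  score s x) @^-1: [set i]))); last first.
  by move=> s; rewrite !inE.
rewrite -big_split /=; apply: ler_sum => s; rewrite !inE => /andP[_ /eqP ->].
by rewrite nat1r.
Qed.

Definition relabel_query g x : query n := [ffun p => x (g.2 p) (+) g.1 p].

(** The automorphism of the cube given by [g], acting on secrets; [relabel_query g] is the inverse
    action on queries, so that scores are preserved. *)
Definition relabel g s : secret n :=
  ([ffun q => s.1 (g.2^-1 q)%g (+) g.1 (g.2^-1 q)%g], s.2 * g.2)%g.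

Lemma score_relabel g s x : score s (relabel_query g x) = score (relabel g s) x.
Proof.
have score_le k : (k <= n)%N ->
    (k <= score s (relabel_query g x))%N = (k <= score (relabel g s) x)%N.
  move=> kn; rewrite !leq_score //; apply: eq_forallb => j.
  rewrite /relabel /= permM !ffunE permK; congr (_ ==> _).
  by case: (s.1 _) (x _) (g.1 _) => [] [] [].
apply/val_inj/eqP.
by rewrite eqn_leq -score_le ?leq_ord // leqnn score_le ?leq_ord /=.
Qed.

Lemma relabel_inj g : injective (relabel g).
Proof.
move=> [z q] [z' q'] [zz' /mulIg ->]; congr pair; apply/ffunP => p.
by have /ffunP/(_ (g.2 p)) := zz'; rewrite !ffunE permK => /addIb.
Qed.

(** Thus a uniformly random [g] sends any fixed secret to a uniformly random one. *)
Lemma relabel_injl s : injective (relabel^~ s).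
Proof.
move=> [z q] [z' q'] [/= /[swap] /mulgI <- zz']; congr pair; apply/ffunP => p.
by have /ffunP/(_ (q p)) := zz'; rewrite !ffunE permK => /addbI.
Qed.

Definition relabel_strategy g T : strategy n :=
  fun v => omap (relabel_query g) (T v).

Lemma transcript_relabel g T s t :
  transcript (relabel_strategy g T) s t =
  omap (map (fun xa => (relabel_query g xa.1, xa.2))) (transcript T (relabel g
    s) t).
Proof.
elim: t => //= t ->; case: (transcript T _ t) => //= h.
rewrite /relabel_strategy -map_comp;
  rewrite (_ : map _ h = [seq xa.2 | xa <- h]) //.
by case: (T _) => //= x; rewrite map_rcons score_relabel.
Qed.

Lemma consistent_relabel g h :
  #|consistent [seq (relabel_query g xa.1, xa.2) | xa <- h]| = #|consistent h|.
Proof.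
rewrite -[RHS](on_card_preimset (f := relabel g)); last first.
  by apply: onW_bij; apply: injF_bij; apply: relabel_inj.
congr #|pred_of_set _|; apply/setP => s; rewrite !inE all_map.
by apply: eq_all => xa /=; rewrite score_relabel.
Qed.

Lemma identified_relabel g T s t h :
    transcript T (relabel g s) t = Some h -> (#|consistent h| <= 1)%N ->
  identified (relabel_strategy g T) s t.
Proof.
move=> Th h1; exists [seq (relabel_query g xa.1, xa.2) | xa <- h].
  by rewrite transcript_relabel Th.
apply/eqP; rewrite consistent_relabel eqn_leq h1 card_gt0.
by apply/set0Pn; exists (relabel g s); apply: transcript_consistent Th.
Qed.

Lemma sum_relabel (tau : secret n -> R) s :
  (\sum_g tau (relabel g s) = \sum_s' tau s')%R.
Proof. by rewrite [RHS](reindex_inj (@relabel_injl s)). Qed.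

End Strategies.

From mathcomp Require Import all_classical all_reals all_analysis.
From mathcomp Require Import measurable_realfun interval_inference.

(** * The uniform mixture of the relabelled trees *)

Section Randomization.
Variables (R : realType) (n : nat).
Local Open Scope classical_set_scope.
Local Open Scope ereal_scope.
Implicit Types (s : secret n) (t : nat) (h : seq (query n * 'I_n.+1)).

Local Notation strategies := (g_sigma_algebraType (@cylinders n)).

(** A prescribed transcript constrains the tree at finitely many addresses, so the event is empty or
    a finite intersection of cylinders. *)
Lemma measurable_transcript s t h :
  measurable ([set T | transcript T s t = Some h] : set strategies).
Proof.
elim: t h => [|t IH] h /=.
  have [->|h0] := eqVneq h [::].
    by rewrite (_ : [set _ | _] = setT) //; apply/seteqP; split.
  rewrite (_ : [set _ | _] = set0) //; apply/seteqP;
    split => // T /= [/esym/eqP].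
  by rewrite (negbTE h0).
case/lastP: h => [|h [x a]].
  rewrite (_ : [set _ | _] = set0) //; apply/seteqP; split => // T /=.
  by case: (transcript T s t) => // h; case: (T _) => // x [] /eqP;
    rewrite -size_eq0 size_rcons.
have [->|xa] := eqVneq a (score s x); last first.
  rewrite (_ : [set _ | _] = set0) //; apply/seteqP; split => // T /=.
  case: (transcript T s t) => // h';
    case: (T _) => // x' [] /rcons_inj[_ -> ax].
  by rewrite ax eqxx in xa.
rewrite (_ : [set _ | _] = [set T | transcript T s t = Some h] `&`
           [set T | T [seq xa.2 | xa <- h] = Some x]).
  apply: measurableI; first exact: IH.
  by apply: sub_sigma_algebra; exists [seq xa.2 | xa <- h], (Some x).
apply/seteqP; split => T /=.
  case: (transcript T s t) => // h';
    case Tx': (T _) => [x'|] // [] /rcons_inj[hh' xx' _].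
  by rewrite -hh' -xx'.
by case=> -> ->.
Qed.

Lemma measurable_identified s t :
  measurable ([set T | identified T s t] : set strategies).
Proof.
(* There are countably many transcripts, enumerated by [unpickle]. *)
pose D (i : nat) : set strategies :=
  if unpickle i is Some h then
    if #|consistent h| == 1%N then [set T | transcript T s t = Some h] else set0
  else set0.
rewrite (_ : [set _ | _] = \bigcup_i D i).
  apply: bigcup_measurable => i _; rewrite /D; case: (unpickle i) => // h.
  by case: ifP => // _; apply: measurable_transcript.
apply/seteqP; split => T /=.
  by case=> h Th /eqP h1; exists (pickle h) => //; rewrite /D pickleK h1.
case=> i _; rewrite /D; case: (unpickle i) => // h.
by case: ifP => // /eqP h1 Th; exists h.
Qed.

Lemma measurable_num_queries s :
  measurable_fun [set: strategies] (num_queries R s).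
Proof.
pose f t (T : strategies) : \bar R :=
  if `[< identified T s t >] then t%:R%:E else +oo.
(* The infimum over a set that depends on [T] becomes one over all [t], with value [+oo] where [t]
   queries do not identify [s]. *)
rewrite (_ : num_queries R s = fun T => einfs (f ^~ T) 0%N).
  apply: measurable_fun_einfs => t; apply: measurable_fun_ifT => //.
  apply: (measurable_fun_bool true); rewrite setTI.
  rewrite (_ : _ @^-1` _ = [set T | identified T s t]).
    exact: measurable_identified.
  by apply/seteqP; split => T /=; [move/asboolP|move=> ?; apply/asboolP].
apply/funext => T; apply/le_anti/andP; split;
  apply: le_ereal_inf_tmp => _ [t tP <-].
  rewrite /f; case: asboolP => [Tt|_]; last exact: leey.
  by apply: ereal_inf_lbound; exists t.
by apply: ereal_inf_lbound; exists t => //; rewrite /f asboolT.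
Qed.

Lemma num_queries_le s T t : identified T s t -> num_queries R s T <= t%:R%:E.
Proof. by move=> Tt; apply: ereal_inf_lbound; exists t. Qed.

Lemma num_queries_ge0 s T : 0 <= num_queries R s T.
Proof. by apply: le_ereal_inf_tmp => _ [t _ <-]; rewrite lee_fin ler0n. Qed.

Section Mixture.
Variables (N : nat) (T_ : nat -> strategies).

Let weight : {nonneg R}%R := (N.+1%:R^-1)%:nng%R.

Definition mixture : set strategies -> \bar R :=
  msum (fun i => mscale weight (dirac (T_ i))) N.+1.

HB.instance Definition _ := Measure.on mixture.

Let mixture_setT : mixture [set: strategies] = 1.
Proof.
rewrite /mixture /msum /mscale /= (eq_bigr (fun=> (N.+1%:R^-1)%:E)); last first.
  by move=> i _; rewrite /mscale /= diracT mule1.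
rewrite sumEFin sumr_const card_ord -(mulr_natr (N.+1%:R^-1)).
by rewrite mulVf ?pnatr_eq0.
Qed.

HB.instance Definition _ :=
  Measure_isProbability.Build _ _ _ mixture mixture_setT.

Lemma expected_queries_mixture s :
  expected_queries mixture s =
  \sum_(i < N.+1) (N.+1%:R^-1)%:E * num_queries R s (T_ i).
Proof.
rewrite /expected_queries /mixture ge0_integral_measure_sum //; first last.
- exact: measurable_num_queries.
- by move=> T _; apply: num_queries_ge0.
apply: eq_bigr => i _; rewrite ge0_integral_mscale //; first last.
- by move=> T _; apply: num_queries_ge0.
- exact: measurable_num_queries.
by rewrite integral_dirac ?diracT ?mul1e //; apply: measurable_num_queries.
Qed.

End Mixture.

(** On [s], the copy of the tree relabelled by [g] asks at most [tau (relabel g s)] queries;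
    averaged over all [g], this is the mean of [tau] over all secrets, whatever [s] is. *)
Lemma randomize (c : R) : cost [set: secret n]%SET (#|{: secret n}|%:R * c)%R ->
  exists P : randomized_strategy R n, forall s, expected_queries P s <= c%:E.
Proof.
move=> /cost_strategy[T [tau [tauP tau_le]]].
have cardN : (0 < #|{: secret n}|)%N by apply/card_gt0P;
  exists ([ffun=> false], 1%g).
pose N := #|{: secret n}|.-1;
  have NE : N.+1 = #|{: secret n}| by rewrite prednK.
pose enum_secret (i : nat) : secret n :=
  nth ([ffun=> false], 1%g) (enum {: secret n}) i.
exists (mixture N (fun i => relabel_strategy (enum_secret i) T)) => s.
rewrite expected_queries_mixture.
apply: (@le_trans _ _ (\sum_(i < N.+1)
   ((N.+1%:R^-1)%R * (tau (relabel (enum_secret i) s))%:R)%:E)).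
  apply: lee_sum => i _; rewrite EFinM lee_wpmul2l ?lee_fin //.
  apply: num_queries_le;
    have [h Th h1] := tauP (relabel (enum_secret i) s) (finset.in_setT _).
  by apply: identified_relabel Th _; rewrite finset.setTI in h1.
rewrite sumEFin lee_fin -mulr_sumr ler_pdivrMl ?ltr0n //.
rewrite [in leRHS]NE; apply: le_trans tau_le.
rewrite [leRHS](eq_bigl xpredT) => [|s']; last by rewrite finset.in_setT.
rewrite -(sum_relabel (fun s' => (tau s')%:R%R) s) -[leRHS]big_enum /=.
by rewrite [leRHS](big_nth ([ffun=> false], 1%g)) big_mkord -cardE -NE.
Qed.

End Randomization.

Theorem theorem4p1 (R : realType) :
  exists (C : R) (n0 : nat), forall n : nat, (n0 <= n)%N ->
    (query_complexity R n <= (C * n%:R * ln (ln n%:R))%:E)%E /\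
    exists P : randomized_strategy R n, forall s : secret n,
      (expected_queries P s <= (C * n%:R * ln (ln n%:R))%:E)%E.
Proof.
have [C [n0 costP]] := cost_setT R; exists C, n0 => n n_large.
have [P P_le] := randomize (costP n n_large); split; last by exists P.
apply: (@le_trans _ _ (complexity P)); first by apply: ereal_inf_lbound;
  exists P.
by apply: ge_ereal_sup => _ [s _ <-].
Qed.
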